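(* Let $p>1$, let $\Omega\subset\mathbb{R}^N$ be a bounded and smooth domain with $N>p$, put $p^*=\frac{pN}{N-p}$, and let $\lambda\in\mathbb{R}$. If $0<r<p^*$ and $p^*>\varpi>q\ge1$, then for each of the functionals $$\mathcal{J}(u)=\frac1r\|u\|_W^r+\frac1q\|u\|_q^q-\frac\lambda\varpi\|u\|_\varpi^\varpi,\qquad \mathcal{J}^+(u)=\frac1r\|u\|_W^r+\frac1q\|u^+\|_q^q-\frac\lambda\varpi\|u^+\|_\varpi^\varpi$$ on $W_0^{1,p}(\Omega)$, the origin is a local minimum with respect to the $L^\infty$ norm, and also with respect to the $W_0^{1,p}$ norm.
   Context: $\|u\|_W=\left(\int_\Omega|\nabla u|^p\right)^{1/p}$ is the norm of $W_0^{1,p}(\Omega)$, $\|\cdot\|_s$ is the $L^s(\Omega)$ norm, $u^+=\max\{u,0\}$. The origin is a local minimum for a functional $J$ with respect to a norm $\|\cdot\|_X$ if there is $\rho>0$ such that $J(u)\ge J(0)$ for all $u\in W_0^{1,p}(\Omega)\cap X$ with $\|u\|_X<\rho$, where $X=L^\infty(\Omega)$ or $X=W_0^{1,p}(\Omega)$, respectively. *)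

(* Defs.v *)
From HB Require Import structures.
From mathcomp Require Import all_boot all_order all_algebra.
From mathcomp Require Import all_classical all_reals all_analysis.

Set Implicit Arguments.
Unset Strict Implicit.
Unset Printing Implicit Defensive.

Import Order.TTheory GRing.Theory Num.Theory.
Import numFieldNormedType.Exports.

Local Open Scope classical_set_scope.
Local Open Scope ring_scope.

Fact rV_measure_display : measure_display.
Proof. exact: default_measure_display. Qed.

(* The sigma-algebra on 'rV[R]_n is generated by the coordinate maps; it is the
   Borel sigma-algebra. *)
Section measurable_rV.
Context {R : realType} (n : nat).

Definition rV_coord (i : 'I_n) (x : 'rV[R]_n) : measurableTypeR R := x ord0 i.

Let rV_set0 : g_sigma_preimage rV_coord set0.
Proof. exact: sigma_algebra0. Qed.

Let rV_setC A : g_sigma_preimage rV_coord A -> g_sigma_preimage rV_coord (~` A).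
Proof. exact: sigma_algebraC. Qed.

Let rV_bigcup (F : _^nat) : (forall i, g_sigma_preimage rV_coord (F i)) ->
  g_sigma_preimage rV_coord (\bigcup_i (F i)).
Proof. exact: sigma_algebra_bigcup. Qed.

HB.instance Definition _ := @isMeasurable.Build rV_measure_display
  'rV[R]_n (g_sigma_preimage rV_coord) rV_set0 rV_setC rV_bigcup.

Lemma measurable_rV_coord i : measurable_fun [set: 'rV[R]_n] (rV_coord i).
Proof.
move=> _ Y mY; rewrite setTI; apply: sub_sigma_algebra => /=.
rewrite -bigcup_seq/=; exists i => /=; first by rewrite mem_index_enum.
by exists Y => //; rewrite setTI.
Qed.

Lemma measurable_fun_rVP d (T : measurableType d) (f : T -> 'rV[R]_n) :
  (forall i, measurable_fun [set: T] (rV_coord i \o f)) ->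
  measurable_fun [set: T] f.
Proof.
move=> mf.
suff : g_sigma_preimage (fun i => rV_coord i \o f) `<=` measurable.
  rewrite g_sigma_preimage_comp => prefS _ A mA.
  by apply: prefS; exists A.
apply: smallest_sub; first exact: sigma_algebra_measurable.
move=> A; rewrite -bigcup_seq => -[i _ [B mB <-]]; exact: mf.
Qed.

End measurable_rV.

Section lebesgue_measure_rV.
Context {R : realType}.
Local Open Scope ereal_scope.

Section step.
Variable n : nat.

Definition rV_cons (z : measurableTypeR R * 'rV[R]_n) : 'rV[R]_n.+1 :=
  \row_i if unlift ord0 i is Some j then z.2 ord0 j else z.1.

Definition rV_uncons (x : 'rV[R]_n.+1) : measurableTypeR R * 'rV[R]_n :=
  (x ord0 ord0, \row_i x ord0 (lift ord0 i)).

Lemma rV_consK : cancel rV_cons rV_uncons.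
Proof.
move=> [a v]; rewrite /rV_uncons mxE unlift_none; congr pair.
by apply/rowP => i; rewrite !mxE liftK.
Qed.

Lemma measurable_rV_cons : measurable_fun [set: _] rV_cons.
Proof.
apply: measurable_fun_rVP => i.
have [j|] := unliftP ord0 i => ->.
  rewrite (_ : _ \o _ = @rV_coord R n j \o snd).
    by apply: measurableT_comp => //; exact: measurable_rV_coord.
  by apply/funext => z /=; rewrite /rV_coord mxE liftK.
rewrite (_ : _ \o _ = fst) //.
by apply/funext => z /=; rewrite /rV_coord mxE unlift_none.
Qed.

Lemma measurable_rV_uncons : measurable_fun [set: _] rV_uncons.
Proof.
apply: measurable_fun_pair; first exact: (measurable_rV_coord ord0).
apply: measurable_fun_rVP => i.
rewrite (_ : _ \o _ = rV_coord (lift ord0 i)); last first.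
  by apply/funext => x; rewrite /rV_coord /= mxE.
exact: measurable_rV_coord.
Qed.

Variable mu : {sigma_finite_measure set 'rV[R]_n -> \bar R}.

Definition lebesgue_step : set 'rV[R]_n.+1 -> \bar R :=
  pushforward (lebesgue_measure \x mu) rV_cons.

HB.instance Definition _ := Measure.copy lebesgue_step
  (measure_function_pushforward__canonical__measure_function_Measure
    (lebesgue_measure \x mu) measurable_rV_cons).

Let lebesgue_step_sigma_finite : sigma_finite setT lebesgue_step.
Proof.
have /sigma_finiteP[F [TF ndF Foo]] := sigma_finiteT (@lebesgue_measure R).
have /sigma_finiteP[G [TG ndG Goo]] := sigma_finiteT mu.
exists (fun k => rV_uncons @^-1` (F k `*` G k)).
  rewrite -preimage_bigcup (_ : \bigcup_k (F k `*` G k) = setT) ?preimage_setT//.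
  rewrite -setXTT TF TG predeqE => -[x y]; split.
    by move=> [k _ []/= ? ?]; split; exists k.
  move=> [/= [k _ Fkx] [l _ Gly]]; exists (maxn k l) => //; split.
  - by move: x Fkx; exact/subsetPset/ndF/leq_maxl.
  - by move: y Gly; exact/subsetPset/ndG/leq_maxr.
move=> k; have [mF Fk] := Foo k; have [mG Gk] := Goo k; split.
  rewrite -[X in measurable X]setTI; apply: measurable_rV_uncons => //.
  exact: measurableX.
rewrite /lebesgue_step /pushforward -comp_preimage (_ : _ \o _ = id).
  by rewrite product_measure1E// lte_mul_pinfty// ge0_fin_numE.
by apply/funext => z /=; rewrite rV_consK.
Qed.

HB.instance Definition _ :=
  @Measure_isSigmaFinite.Build _ _ _ lebesgue_step lebesgue_step_sigma_finite.

End step.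

(* N-dimensional Lebesgue measure as the iterated product of the measure of R,
   transported along R * R^n = R^(n+1); see lebesgue_rV_box for its values. *)
Fixpoint lebesgue_rV n : {sigma_finite_measure set 'rV[R]_n -> \bar R} :=
  match n with
  | 0%N => \d_ (0%R : 'rV[R]_0)
  | n'.+1 => lebesgue_step (lebesgue_rV n')
  end.

End lebesgue_measure_rV.

Lemma measurable_rV_box {R : realType} n (A : 'I_n -> set (measurableTypeR R)) :
  (forall i, measurable (A i)) ->
  measurable [set x : 'rV[R]_n | forall i, A i (x ord0 i)].
Proof.
move=> mA; rewrite (_ : mkset _ = \bigcap_i (rV_coord i @^-1` A i)).
  apply: fin_bigcap_measurable => [|i _]; first exact: finite_finset.
  by rewrite -[X in measurable X]setTI; exact: measurable_rV_coord.
by apply/seteqP; split => x /= Ax i => [_|]; exact: Ax.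
Qed.

Lemma lebesgue_rV_box {R : realType} n (A : 'I_n -> set (measurableTypeR R)) :
  (forall i, measurable (A i)) ->
  lebesgue_rV n [set x : 'rV[R]_n | forall i, A i (x ord0 i)] =
  (\prod_i lebesgue_measure (A i))%E.
Proof.
elim: n A => [|n IH] A mA.
  rewrite big_ord0 /= diracE mem_set//= => -[].
  by case.
rewrite big_ord_recl -IH// -product_measure1E//; last first.
  by apply: (measurable_rV_box (A := fun i => A (lift ord0 i))) => i; exact: mA.
rewrite /= /lebesgue_step /pushforward; congr (_ _).
apply/seteqP; split => z /=.
  move=> Az; split => [|i].
    by have := Az ord0; rewrite mxE unlift_none.
  by have := Az (lift ord0 i); rewrite mxE liftK.
by move=> [A0 Ai] i; rewrite mxE; case: unliftP => [j ->|->].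
Qed.

Section smooth_functions.
Context {R : realType}.

Definition partial n (i : 'I_n) (f : 'rV[R]_n -> R) : 'rV[R]_n -> R :=
  fun x => 'D_(delta_mx ord0 i) f x.

Definition gradient n (f : 'rV[R]_n -> R) : 'rV[R]_n -> 'rV[R]_n :=
  fun x => \row_i partial i f x.

(* C^k through iterated partial derivatives: f is C^(k+1) iff all its partial
   derivatives exist everywhere and are C^k; continuity of f is then redundant. *)
Fixpoint is_Ck (k : nat) n (f : 'rV[R]_n -> R) : Prop :=
  match k with
  | 0%N => continuous f
  | k'.+1 => continuous f /\
      forall i, (forall x, derivable f x (delta_mx ord0 i)) /\
                is_Ck k' (partial i f)
  end.

Definition is_Cinfty n (f : 'rV[R]_n -> R) : Prop := forall k, is_Ck k f.

(* Near each boundary point, after relabelling (i) and reorienting (s) the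
   coordinate axes, Omega is the region above the graph of a C^oo function
   gamma of the n - 1 remaining coordinates.  Balls of 'rV[R]_n are cubes (sup
   norm), which is immaterial here. *)
Definition smooth_boundary n (Omega : set 'rV[R]_n) : Prop :=
  forall x, (closure Omega `\` interior Omega) x ->
  exists (e : R) (i : 'I_n) (s : bool) (gamma : 'rV[R]_n.-1 -> R),
    [/\ 0 < e, is_Cinfty gamma &
        Omega `&` ball x e =
        [set y | gamma (col' i y) < (-1) ^+ s * y ord0 i] `&` ball x e].

Definition bounded_smooth_domain n (Omega : set 'rV[R]_n) : Prop :=
  [/\ Omega !=set0, open Omega, connected Omega, bounded_set Omega &
      smooth_boundary Omega].

Definition test_function n (Omega : set 'rV[R]_n) (phi : 'rV[R]_n -> R) : Prop :=
  [/\ is_Cinfty phi, compact (closure [set x | phi x != 0]) &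
      closure [set x | phi x != 0] `<=` Omega].

End smooth_functions.

Section sobolev.
Context {R : realType} {N : nat}.
Implicit Types (Omega : set 'rV[R]_N) (f u : 'rV[R]_N -> R).
Local Open Scope ereal_scope.

Definition enorm (v : 'rV[R]_N) : R := Num.sqrt (\sum_i (v ord0 i) ^+ 2)%R.

(* L^s(Omega) norm of a function defined on all of R^N, whose values outside
   Omega are discarded; s = +oo gives the essential supremum of |f|. *)
Definition norm_L Omega (s : \bar R) f : \bar R :=
  'N[lebesgue_rV N]_s[(EFin \o f) \_ Omega].

Definition in_L Omega (s : \bar R) f : Prop :=
  measurable_fun Omega f /\ norm_L Omega s f < +oo.

Definition weak_gradient Omega u (g : 'rV[R]_N -> 'rV[R]_N) : Prop :=
  forall phi, test_function Omega phi -> forall i,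
    \int[lebesgue_rV N]_(x in Omega) (u x * partial i phi x)%:E =
    - \int[lebesgue_rV N]_(x in Omega) (g x ord0 i * phi x)%:E.

(* Elements of W_0^{1,p}(Omega): functions u of W^{1,p}(Omega), given together
   with their weak gradient (unique up to a null set), which are limits in
   W^{1,p}(Omega) of a sequence in C_c^oo(Omega). Functions are not quotiented
   by almost-everywhere equality. *)
Record W01p (p : R) Omega := MkW01p {
  Wfun :> 'rV[R]_N -> R ;
  Wgrad : 'rV[R]_N -> 'rV[R]_N ;
  Wfun_Lp : in_L Omega p%:E Wfun ;
  Wgrad_Lp : forall i, in_L Omega p%:E (fun x => Wgrad x ord0 i) ;
  Wgrad_weak : weak_gradient Omega Wfun Wgrad ;
  Wclosure : exists phi : nat -> 'rV[R]_N -> R,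
    [/\ forall k, test_function Omega (phi k),
        norm_L Omega p%:E (fun x => phi k x - Wfun x)%R @[k --> \oo] --> 0 &
        norm_L Omega p%:E (fun x => enorm (gradient (phi k) x - Wgrad x))
          @[k --> \oo] --> 0]
}.

Lemma enorm0 : enorm 0 = 0%R.
Proof. by rewrite /enorm big1 ?sqrtr0// => i _; rewrite mxE expr0n. Qed.

Lemma norm_L0 Omega (s : \bar R) : s != 0 -> norm_L Omega s (cst 0%R) = 0.
Proof.
move=> s0; rewrite /norm_L (_ : _ \_ _ = cst 0) ?Lnorm0//.
by apply/funext => x; rewrite patchE; case: ifP.
Qed.

Lemma partial_cst n (i : 'I_n) (c : R) : partial i (cst c) = cst 0%R.
Proof. by apply/funext => x; exact: derive_cst. Qed.

Lemma is_Cinfty_cst n (c : R) : is_Cinfty (cst c : 'rV[R]_n -> R).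
Proof.
move=> k; elim: k c => [|k IH] c /=; first exact: cst_continuous.
split=> [|i]; first exact: cst_continuous.
by split=> [x|]; [exact: derivable_cst|rewrite partial_cst].
Qed.

Lemma test_function0 Omega : test_function Omega (cst 0%R).
Proof.
rewrite /test_function (_ : [set x | _] = set0) ?closure0.
  by split=> //; [exact: is_Cinfty_cst|exact: compact0].
by apply/seteqP; split => // x /=; rewrite eqxx.
Qed.

Section origin.
Variables (p : R) (Omega : set 'rV[R]_N).
Hypothesis p1 : (1 < p)%R.

Let p0 : p%:E != 0.
Proof. by rewrite eqe gt_eqF// (lt_trans ltr01). Qed.

Let in_L0 : in_L Omega p%:E (cst 0%R).
Proof. by split; [exact: measurable_cst|rewrite norm_L0 ?ltry]. Qed.

Let grad_in_L0 i : in_L Omega p%:E (fun x => (cst 0%R : 'rV[R]_N -> 'rV[R]_N) x ord0 i).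
Proof.
by rewrite (_ : (fun x => _) = cst 0%R)//; apply/funext => x; rewrite mxE.
Qed.

Let weak_gradient0 : weak_gradient Omega (cst 0%R) (cst 0%R).
Proof.
move=> phi _ i; rewrite !integral0_eq ?oppe0// => x _.
- by rewrite mxE mul0r.
- by rewrite mul0r.
Qed.

Let closure_test0 : exists phi : nat -> 'rV[R]_N -> R,
  [/\ forall k, test_function Omega (phi k),
      norm_L Omega p%:E (fun x => phi k x - cst 0%R x)%R @[k --> \oo] --> 0 &
      norm_L Omega p%:E (fun x => enorm (gradient (phi k) x - cst 0%R x))
        @[k --> \oo] --> 0].
Proof.
exists (fun=> cst 0%R); split => [_||]; first exact: test_function0.
- have f0 : (fun x => (cst 0%R : 'rV[R]_N -> R) x - (cst 0%R : 'rV[R]_N -> R) x)%R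
      = cst 0%R by apply/funext => x; exact: subr0.
  by rewrite f0 norm_L0//; exact: cvg_cst.
- have g0 : (fun x => enorm (gradient (cst 0%R : 'rV[R]_N -> R) x
      - (cst 0%R : 'rV[R]_N -> 'rV[R]_N) x)) = cst 0%R.
    apply/funext => x; rewrite [X in enorm X]subr0 (_ : gradient _ _ = 0%R) ?enorm0//.
    by apply/rowP => i; rewrite !mxE partial_cst.
  by rewrite g0 norm_L0//; exact: cvg_cst.
Qed.

Definition W_origin : W01p p Omega :=
  MkW01p in_L0 grad_in_L0 weak_gradient0 closure_test0.

End origin.

Definition norm_W p Omega (u : W01p p Omega) : \bar R :=
  norm_L Omega p%:E (fun x => enorm (Wgrad u x)).

Definition pos_part u : 'rV[R]_N -> R := fun x => Num.max (u x) 0%R.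

(* The functionals take values in \bar R, so that no term needs to be truncated;
   on W_0^{1,p}(Omega) all the terms are finite when r > 0 and
   1 <= q < varpi < p^*. *)
Definition J_functional (r q varpi lambda p : R) Omega (u : W01p p Omega) : \bar R :=
  (r^-1)%:E * norm_W u `^ r
  + (q^-1)%:E * norm_L Omega q%:E u `^ q
  - (lambda / varpi)%:E * norm_L Omega varpi%:E u `^ varpi.

Definition Jplus_functional (r q varpi lambda p : R) Omega (u : W01p p Omega) : \bar R :=
  (r^-1)%:E * norm_W u `^ r
  + (q^-1)%:E * norm_L Omega q%:E (pos_part u) `^ q
  - (lambda / varpi)%:E * norm_L Omega varpi%:E (pos_part u) `^ varpi.

(* normX u < rho forces u to have finite X-norm, i.e., to lie in X. *)
Definition origin_local_min p Omega (p1 : (1 < p)%R)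
    (normX J : W01p p Omega -> \bar R) : Prop :=
  exists2 rho : R, (0 < rho)%R &
    forall u : W01p p Omega, normX u < rho%:E -> J (W_origin Omega p1) <= J u.

End sobolev.

(* Main.v *)
Require Import Defs.
From mathcomp Require Import all_boot all_order all_algebra.
From mathcomp Require Import all_classical all_reals all_analysis.
From mathcomp Require Import measurable_realfun ess_sup_inf.
From mathcomp Require Import ring lra.

(** On the ball of radius rho both functionals are nonnegative, while they
    vanish at the origin.  If lambda <= 0 every term is nonnegative; otherwise the
    point is to absorb the term in |v|^varpi, where v is u or its positive part.

    In the sup norm this is pointwise: as varpi > q, for small |a| one has
    (lambda / varpi) |a|^varpi <= (1 / q) |a|^q (absorption_le).

    In the W norm, u need not be small pointwise.  Where |a| exceeds the
    threshold, |a|^varpi is at most a constant times |a|^s, with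
    s = p N / (N - p) the critical exponent, so that
    (lambda / varpi) |a|^varpi <= (1 / q) |a|^q + C |a|^s everywhere
    (absorption_critical_le).  The Sobolev inequality bounds the integral of
    |u|^s by C' t^s, with t the W norm of u, and t^s is o(t^r) because r < s.
    So the last term is absorbed by t^r / r for small t (energy_W_ge0).

    The Sobolev inequality (sobolev_inequality) follows Gagliardo and
    Nirenberg.  For a test function phi and gamma = p (N - 1) / (N - p) > 1,
    integrating the derivative of |phi|^gamma along coordinate lines gives
    |phi|^gamma <= I_i for every i, where I_i(x) is the integral of
    g_i = gamma |phi|^(gamma - 1) |d_i phi| over the line through x in
    direction i.  An inequality of Loomis-Whitney type
    (ge0_integral_line_integrals) bounds the integral of
    h^(1/N) prod_i I_i^(1/N) by the product of the integrals of h and of the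
    g_i, each to the power 1/N.  For h = |phi|^s the left-hand side dominates
    the integral Y of |phi|^s, and Hoelder's inequality on each g_i yields
    Y <= Y^(1/N) gamma Y^(1 - 1/p) ||grad phi||_p, which can be solved for Y
    since Y is finite (sobolev_absorb).  The inequality passes to the closure
    W_0^{1,p} through truncations min(|u|, M), for which convergence in L^p of
    the approximating test functions suffices (sobolev_truncation); then M
    tends to infinity. *)

Import Order.TTheory GRing.Theory Num.Theory.
Import numFieldNormedType.Exports.

Set Implicit Arguments.
Unset Strict Implicit.
Unset Printing Implicit Defensive.

Local Open Scope classical_set_scope.
Local Open Scope ring_scope.

(** * Hoelder's inequality for nonnegative extended-real functions *)

Lemma weighted_AGM (R : realType) (a x y : R) :
  0 < a < 1 -> 0 <= x -> 0 <= y ->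
  x `^ a * y `^ (1 - a) <= a * x + (1 - a) * y.
Proof.
move=> /andP[a0 a1] x0 y0; have b0 : 0 < 1 - a by rewrite subr_gt0.
have ai : 0 < a^-1 by rewrite invr_gt0.
have bi : 0 < (1 - a)^-1 by rewrite invr_gt0.
have := conjugate_powR (powR_ge0 x a) (powR_ge0 y (1 - a)) ai bi.
rewrite !invrK -!powRrM !divff ?gt_eqF//.
by rewrite !powRr1// (mulrC x) (mulrC y); apply; ring.
Qed.

(** Arithmetic of the exponents that lets Hoelder's inequality peel off one factor
    out of n + 2: the other n + 1 share the weight 1 - 1/(n + 2) equally. *)
Lemma inv_succ_conjugate (R : realType) n :
  n.+1%:R^-1 * (1 - n.+2%:R^-1) = n.+2%:R^-1 :> R.
Proof.
have : n.+1%:R != 0 :> R by rewrite pnatr_eq0.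
have : n.+2%:R != 0 :> R by rewrite pnatr_eq0.
rewrite -(natr1 n.+1) => n2 n1; by field; apply/andP.
Qed.

Section hoelder.
Context d (T : measurableType d) (R : realType).
Variable mu : {measure set T -> \bar R}.
Local Open Scope ereal_scope.

Lemma integral_eq0_ae (F : T -> \bar R) : measurable_fun setT F ->
  (forall x, 0 <= F x) -> \int[mu]_x F x = 0 -> ae_eq mu setT F (cst 0).
Proof.
move=> mF F0 iF; apply/ae_eq_integral_abs => //.
by under eq_integral => x _ do rewrite gee0_abs//.
Qed.

Lemma integral_poweR_mul_eq0 (F G : T -> \bar R) (a b : R) :
  measurable_fun setT F -> measurable_fun setT G -> (a != 0)%R ->
  (forall x, 0 <= F x) -> \int[mu]_x F x = 0 ->
  \int[mu]_x (F x `^ a * G x `^ b) = 0.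
Proof.
move=> mF mG a0 F0 iF.
rewrite (ae_eq_integral (cst 0)) ?integral0//.
- by apply: emeasurable_funM; exact: (measurableT_comp (measurable_poweR _)).
- apply: filterS (integral_eq0_ae mF F0 iF) => x /= /(_ I) -> _.
  by rewrite poweR0r// mul0e.
Qed.

(** After normalising F and G by their integrals this is the weighted AM-GM
    inequality integrated; the degenerate integrals 0 and +oo are separate cases.
    Extended-real values are allowed because integrals along lines may diverge. *)
Lemma ge0_hoelder (F G : T -> \bar R) (a : R) : (0 < a < 1)%R ->
  measurable_fun setT F -> measurable_fun setT G ->
  (forall x, 0 <= F x) -> (forall x, 0 <= G x) ->
  \int[mu]_x (F x `^ a * G x `^ (1 - a)) <=
  (\int[mu]_x F x) `^ a * (\int[mu]_x G x) `^ (1 - a).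
Proof.
move=> a01 mF mG F0 G0; have /andP[a0 a1] := a01.
have b0 : (0 < 1 - a)%R by rewrite subr_gt0.
set A := \int[mu]_x F x; set B := \int[mu]_x G x.
have A0 : 0 <= A by exact: integral_ge0.
have B0 : 0 <= B by exact: integral_ge0.
have [Az|Anz] := eqVneq A 0.
  by rewrite (integral_poweR_mul_eq0 _ _ _ _ _ Az) ?mule_ge0 ?poweR_ge0 ?gt_eqF.
have [Bz|Bnz] := eqVneq B 0.
  under eq_integral => x _ do rewrite muleC.
  by rewrite (integral_poweR_mul_eq0 _ _ _ _ _ Bz) ?mule_ge0 ?poweR_ge0 ?gt_eqF.
have Apos : 0 < A by rewrite lt0e Anz.
have Bpos : 0 < B by rewrite lt0e Bnz.
have [Ay|Ay] := eqVneq A +oo.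
  by rewrite Ay poweRyr ?gt_eqF// gt0_mulye ?leey// poweR_gt0.
have [By|By] := eqVneq B +oo.
  by rewrite By poweRyr ?gt_eqF// gt0_muley ?leey// poweR_gt0.
move: A0 B0 Apos Bpos Ay By; case EA : A => [s| |]//; case EB : B => [t| |]// _ _.
rewrite !lte_fin => s0 t0 _ _.
pose c1 := (s `^ a * t `^ (1 - a) * (a / s))%R.
pose c2 := (s `^ a * t `^ (1 - a) * ((1 - a) / t))%R.
have c1_gt0 : (0 < c1)%R by rewrite !mulr_gt0 ?powR_gt0 ?invr_gt0.
have c2_gt0 : (0 < c2)%R by rewrite !mulr_gt0 ?powR_gt0 ?invr_gt0.
have key x : F x `^ a * G x `^ (1 - a) <=
    c1%:E * F x + c2%:E * G x.
  have [Fy|Fy] := eqVneq (F x) +oo.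
    by rewrite Fy gt0_muley ?lte_fin// addye ?leey// -ltNye
      (lt_le_trans _ (mule_ge0 _ (G0 x))) ?lee_fin ?ltW.
  have [Gy|Gy] := eqVneq (G x) +oo.
    by rewrite Gy gt0_muley ?lte_fin// addey ?leey// -ltNye
      (lt_le_trans _ (mule_ge0 _ (F0 x))) ?lee_fin ?ltW.
  have := F0 x; have := G0 x; move: Fy Gy.
  case: (F x) => [f| |]//; case: (G x) => [g| |]// _ _.
  rewrite !lee_fin => g0 f0.
  have f'0 : (0 <= f / s)%R by rewrite divr_ge0// ltW.
  have g'0 : (0 <= g / t)%R by rewrite divr_ge0// ltW.
  have := weighted_AGM a01 f'0 g'0.
  have -> : (f `^ a = s `^ a * (f / s) `^ a)%R.
    by rewrite -powRM ?(ltW s0)// mulrC divfK ?gt_eqF.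
  have -> : (g `^ (1 - a) = t `^ (1 - a) * (g / t) `^ (1 - a))%R.
    by rewrite -powRM ?(ltW t0)// mulrC divfK ?gt_eqF.
  move=> /(ler_wpM2l (_ : 0 <= s `^ a * t `^ (1 - a))%R).
  rewrite mulr_ge0 ?powR_ge0// => /(_ erefl) h.
  rewrite mulrACA.
  apply: (le_trans h); rewrite le_eqVlt; apply/orP; left; apply/eqP.
  by rewrite /c1 /c2; field; rewrite !gt_eqF.
have mM : measurable_fun setT (fun x => F x `^ a * G x `^ (1 - a)).
  by apply: emeasurable_funM; exact: (measurableT_comp (measurable_poweR _)).
apply: (@le_trans _ _ (\int[mu]_x (c1%:E * F x + c2%:E * G x))).
  apply: ge0_le_integral => //.
  - by move=> x _; rewrite mule_ge0 ?poweR_ge0.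
  - by apply: emeasurable_funD; apply: emeasurable_funM.
rewrite ge0_integralD//; last 4 first.
- by move=> x _; rewrite mule_ge0 ?lee_fin// ltW.
- exact: emeasurable_funM.
- by move=> x _; rewrite mule_ge0 ?lee_fin// ltW.
- exact: emeasurable_funM.
rewrite !ge0_integralZl ?lee_fin ?(ltW c1_gt0) ?(ltW c2_gt0)// -/A -/B EA EB.
rewrite -!EFinM -EFinD lee_fin /c1 /c2.
by rewrite le_eqVlt; apply/orP; left; apply/eqP; field; rewrite !gt_eqF.
Qed.

Lemma prode_poweR (I : Type) (r : seq I) (F : I -> \bar R) (a : R) :
  (forall i, 0 <= F i) ->
  (\prod_(i <- r) F i) `^ a = \prod_(i <- r) (F i `^ a).
Proof.
move=> F0; elim: r => [|i r IH]; first by rewrite !big_nil poweR1r.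
by rewrite !big_cons poweRM ?IH// prode_ge0.
Qed.

Lemma le_prode (I : Type) (r : seq I) (F G : I -> \bar R) :
  (forall i, 0 <= F i <= G i) ->
  \prod_(i <- r) F i <= \prod_(i <- r) G i.
Proof.
move=> FG; elim: r => [|i r IH]; first by rewrite !big_nil.
have /andP[F0 leFG] := FG i.
rewrite !big_cons lee_pmul// prode_ge0// => j _; by case/andP: (FG j).
Qed.

Lemma emeasurable_prod (I : Type) (r : seq I) (F : I -> T -> \bar R) :
  (forall i, measurable_fun setT (F i)) ->
  measurable_fun setT (fun x => \prod_(i <- r) F i x).
Proof.
move=> mF; elim: r => [|i r IH].
  by under eq_fun do rewrite big_nil; exact: measurable_cst.
by under eq_fun do rewrite big_cons; exact: emeasurable_funM.
Qed.

Lemma ge0_hoelder_prod n (F : 'I_n.+1 -> T -> \bar R) :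
  (forall i, measurable_fun setT (F i)) -> (forall i x, 0 <= F i x) ->
  \int[mu]_x \prod_i (F i x `^ n.+1%:R^-1) <=
  \prod_i (\int[mu]_x F i x) `^ n.+1%:R^-1.
Proof.
elim: n F => [|n IH] F mF F0.
  rewrite big_ord1 invr1 poweRe1 ?integral_ge0//.
  by under eq_integral => x _ do rewrite big_ord1 poweRe1//.
have n01 : (0 < (n.+2%:R^-1 : R) < 1)%R.
  by rewrite invr_gt0 ltr0n invf_lt1 ?ltr0n// ltr1n.
pose G x := \prod_(i < n.+1) (F (lift ord0 i) x `^ n.+1%:R^-1).
have G0 x : 0 <= G x by apply: prode_ge0 => i _; exact: poweR_ge0.
have mG : measurable_fun setT G.
  by apply: emeasurable_prod => i; exact: (measurableT_comp (measurable_poweR _)).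
have -> : \int[mu]_x \prod_i (F i x `^ n.+2%:R^-1) =
    \int[mu]_x (F ord0 x `^ n.+2%:R^-1 * G x `^ (1 - n.+2%:R^-1)).
  apply: eq_integral => x _; rewrite big_ord_recl prode_poweR; last first.
    by move=> i; exact: poweR_ge0.
  by congr (_ * _); apply: eq_bigr => i _; rewrite -poweRrM inv_succ_conjugate.
apply: (le_trans (ge0_hoelder n01 _ mG _ _)) => //.
rewrite big_ord_recl; apply: lee_wpmul2l; first exact: poweR_ge0.
apply: (@le_trans _ _ ((\prod_(i < n.+1)
    (\int[mu]_x F (lift ord0 i) x) `^ n.+1%:R^-1) `^ (1 - n.+2%:R^-1))).
  apply: gt0_ler_poweR; rewrite ?in_itv/= ?leey ?andbT.
  - by rewrite subr_ge0 ltW//; case/andP: n01.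
  - exact: integral_ge0.
  - by apply: prode_ge0 => i _; exact: poweR_ge0.
  - exact: IH.
rewrite prode_poweR; last by move=> i; exact: poweR_ge0.
by under eq_bigr => i _ do rewrite -poweRrM inv_succ_conjugate.
Qed.

End hoelder.

(** * Measurability and iterated integrals in R^n *)

Lemma measurable_EFin_powR d (T : measurableType d) (R : realType)
    (D : set T) (f : T -> R) (a : R) : measurable_fun D f ->
  measurable_fun D (fun x => (f x `^ a)%:E).
Proof.
move=> mf; apply/measurable_EFinP.
exact: (measurableT_comp (measurable_powR _)).
Qed.

Lemma measurable_EFin_norm_powR d (T : measurableType d) (R : realType)
    (D : set T) (f : T -> R) (a : R) : measurable_fun D f ->
  measurable_fun D (fun x => (`|f x| `^ a)%:E).
Proof. by move=> mf; apply: measurable_EFin_powR; exact: measurableT_comp. Qed.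

Section borel_rV.
Context (R : realType) (n : nat).

Lemma measurable_rV_ball (x : 'rV[R]_n) (e : R) : 0 < e -> measurable (ball x e).
Proof.
move=> e0.
rewrite (_ : ball x e = [set y | forall i, ball (x ord0 i) e (y ord0 i)]).
  apply: (@measurable_rV_box R n (fun i => ball (x ord0 i) e)) => i.
  exact: (open_measurable (@ball_open R R^o (x ord0 i) e)).
apply/seteqP; split => y /=; first by move=> [_ xy] i; exact: xy.
by move=> xy; split => // i j; rewrite (ord1 i).
Qed.

(** The sigma-algebra of 'rV_n is generated by the coordinates only, so an open
    set is written as a countable union of cubes with rational centres. *)
Lemma open_measurable_rV (A : set 'rV[R]_n) : open A -> measurable A.
Proof.
move=> oA.
pose q2R (q : 'rV[rat]_n) : 'rV[R]_n := map_mx ratr q.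
pose B (qk : 'rV[rat]_n * nat) : set 'rV[R]_n :=
  if `[< ball (q2R qk.1) qk.2.+1%:R^-1 `<=` A >] then
  ball (q2R qk.1) qk.2.+1%:R^-1 else set0.
rewrite (_ : A = \bigcup_qk B qk).
  apply: countable_bigcupT_measurable => [|qk]; first exact: countableP.
  by rewrite /B; case: ifP => _ //; apply: measurable_rV_ball; rewrite invr_gt0.
apply/seteqP; split => [x Ax|x [qk _]]; last first.
  by rewrite /B; case: asboolP => [h /h|_ []].
have /nbhs_ballP[e /= e0 eA] := open_nbhs_nbhs (conj oA Ax).
have [k ke] : exists k : nat, k.+1%:R^-1 < e / 2.
  exists (Num.trunc (e / 2)^-1); rewrite invf_plt ?posrE ?divr_gt0//.
  exact: truncnS_gt.
have /choice[q qx] j : exists q : rat, `|x ord0 j - ratr q| < k.+1%:R^-1.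
  have /rat_in_itvoo[q] : x ord0 j - k.+1%:R^-1 < x ord0 j + k.+1%:R^-1.
    by rewrite ltrBlDr -addrA ltrDl addr_gt0// invr_gt0.
  by rewrite in_itv/= => qx; exists q; rewrite distrC ltr_distl.
have xq : ball (q2R (\row_j q j)) k.+1%:R^-1 x.
  by split=> [|i j]; rewrite ?invr_gt0// (ord1 i) !mxE /ball/= distrC.
exists (\row_j q j, k) => //; rewrite /B/=; case: asboolP => // -[] y qy.
apply: eA; apply: (ball_splitl (z := q2R (\row_j q j))).
  by apply/ball_sym; apply: le_ball xq; exact: ltW.
by apply/ball_sym; apply: le_ball qy; exact: ltW.
Qed.

Lemma continuous_measurable_rV (f : 'rV[R]_n -> R) :
  continuous f -> measurable_fun [set: 'rV[R]_n] f.
Proof.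
move=> cf; apply: (measurability _ (RGenOpens.measurableE R)).
move=> _ [_ [a [b ->] <-]]; rewrite setTI.
by apply: open_measurable_rV; move/continuousP : cf; apply; exact: interval_open.
Qed.

End borel_rV.

Section line_integral.
Context {R : realType}.
Local Open Scope ereal_scope.

Definition set_coord n (x : 'rV[R]_n) (i : 'I_n) (t : R) : 'rV[R]_n :=
  \row_j if j == i then t else x ord0 j.

Definition line_integral n (g : 'rV[R]_n -> \bar R) (i : 'I_n) (x : 'rV[R]_n) :=
  \int[lebesgue_measure]_t g (set_coord x i t).

Lemma line_integral_ge0 n (g : 'rV[R]_n -> \bar R) i x :
  (forall y, 0 <= g y) -> 0 <= line_integral g i x.
Proof. by move=> g0; exact: integral_ge0. Qed.

Lemma measurable_line_integral n (g : 'rV[R]_n -> \bar R) i :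
  (forall y, 0 <= g y) -> measurable_fun [set: 'rV[R]_n] g ->
  measurable_fun [set: 'rV[R]_n] (line_integral g i).
Proof.
move=> g0 mg.
pose h (z : 'rV[R]_n * measurableTypeR R) := g (set_coord z.1 i z.2).
apply: (@measurable_fun_fubini_tonelli_F _ _ _ _ _ lebesgue_measure h).
  apply: measurableT_comp => //; apply: measurable_fun_rVP => j.
  rewrite (_ : _ \o _ = if j == i then snd else rV_coord j \o fst).
    by case: ifP => _ //; apply: measurableT_comp => //; exact: measurable_rV_coord.
  by apply/funext => z; rewrite /rV_coord /= mxE; case: ifP.
by move=> z; exact: g0.
Qed.

Lemma set_coord_cons0 n (y : R) (z : 'rV[R]_n) t :
  set_coord (rV_cons (y, z)) ord0 t = rV_cons (t, z).
Proof.
apply/rowP => j; rewrite !mxE; case: unliftP => [k ->|->]; last by rewrite eqxx.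
by rewrite eq_sym (negbTE (neq_lift _ _)).
Qed.

Lemma set_coord_cons n (y : R) (z : 'rV[R]_n) i t :
  set_coord (rV_cons (y, z)) (lift ord0 i) t = rV_cons (y, set_coord z i t).
Proof.
apply/rowP => j; rewrite !mxE; case: (unliftP ord0 j) => [k ->|->].
  by rewrite (inj_eq (@lift_inj _ _)) mxE.
by rewrite (negbTE (neq_lift _ _)).
Qed.

Lemma ge0_integral_rV_cons n (f : 'rV[R]_n.+1 -> \bar R) :
  (forall x, 0 <= f x) -> measurable_fun [set: 'rV[R]_n.+1] f ->
  \int[lebesgue_rV n.+1]_x f x =
  \int[lebesgue_measure]_y \int[lebesgue_rV n]_z f (rV_cons (y, z)).
Proof.
move=> f0 mf.
have mh : measurable_fun [set: measurableTypeR R * 'rV[R]_n] (f \o @rV_cons R n).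
  by apply: measurableT_comp => //; exact: measurable_rV_cons.
have h0 z : 0 <= (f \o @rV_cons R n) z by exact: f0.
rewrite -(@fubini_tonelli1 _ _ _ _ _ lebesgue_measure (lebesgue_rV n) _ mh h0).
rewrite /= /lebesgue_step.
by rewrite (ge0_integral_pushforward (measurable_rV_cons (n := n))).
Qed.

Lemma measurable_rV_cons_section n (f : 'rV[R]_n.+1 -> \bar R) y :
  measurable_fun [set: 'rV[R]_n.+1] f ->
  measurable_fun [set: 'rV[R]_n] (fun z => f (rV_cons (y, z))).
Proof.
move=> mf; apply: measurableT_comp => //.
apply: measurableT_comp; first exact: measurable_rV_cons.
exact: measurable_fun_pair.
Qed.

Lemma measurable_integral_rV_cons n (f : 'rV[R]_n.+1 -> \bar R) :
  (forall x, 0 <= f x) -> measurable_fun [set: 'rV[R]_n.+1] f ->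
  measurable_fun [set: measurableTypeR R]
    (fun y => \int[lebesgue_rV n]_z f (rV_cons (y, z))).
Proof.
move=> f0 mf.
apply: (@measurable_fun_fubini_tonelli_F _ _ _ _ _ (lebesgue_rV n) (f \o @rV_cons R n)).
  by apply: measurableT_comp => //; exact: measurable_rV_cons.
by move=> z; exact: f0.
Qed.

End line_integral.

(** * A Loomis-Whitney inequality for integrals along lines *)

Section gagliardo.
Context {R : realType}.
Local Open Scope ereal_scope.

Lemma ge0_integral_rV1 (f : 'rV[R]_1 -> \bar R) x :
  (forall x, 0 <= f x) -> measurable_fun [set: 'rV[R]_1] f ->
  \int[lebesgue_rV 1]_x f x = line_integral f ord0 x.
Proof.
move=> f0 mf; rewrite ge0_integral_rV_cons//; apply: eq_integral => y _.
rewrite integral_dirac//; last exact: measurable_rV_cons_section.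
rewrite diracT mul1e; congr f; apply/rowP => j.
by rewrite !mxE !(ord1 j) eqxx unlift_none.
Qed.

Lemma ge0_integral_rV_cons_swap n (f : 'rV[R]_n.+1 -> \bar R) :
  (forall x, 0 <= f x) -> measurable_fun [set: 'rV[R]_n.+1] f ->
  \int[lebesgue_rV n.+1]_x f x =
  \int[lebesgue_rV n]_z \int[lebesgue_measure]_y f (rV_cons (y, z)).
Proof.
move=> f0 mf; rewrite ge0_integral_rV_cons//.
have mh : measurable_fun [set: measurableTypeR R * 'rV[R]_n] (f \o @rV_cons R n).
  by apply: measurableT_comp => //; exact: measurable_rV_cons.
have h0 z : 0 <= (f \o @rV_cons R n) z by exact: f0.
exact: (@fubini_tonelli _ _ _ _ _ lebesgue_measure (lebesgue_rV n) _ mh h0).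
Qed.

(** By induction on the dimension.  Split x = (y, z) with y the first coordinate.
    The integral along the first direction depends on z alone, the others at
    fixed y are integrals along lines of z-space.  At fixed y, Hoelder with
    weight 1/(n + 2) on the former and the induction hypothesis on the latter
    leave a product of n + 2 functions of y to the power 1/(n + 2), to which
    the product form of Hoelder applies.  The extra factor h is what makes the
    one-dimensional case trivial and lets the induction start there. *)
Lemma ge0_integral_line_integrals n (h : 'rV[R]_n.+1 -> \bar R)
    (g : 'I_n.+1 -> 'rV[R]_n.+1 -> \bar R) :
  (forall x, 0 <= h x) -> measurable_fun [set: 'rV[R]_n.+1] h ->
  (forall i x, 0 <= g i x) ->
  (forall i, measurable_fun [set: 'rV[R]_n.+1] (g i)) ->
  \int[lebesgue_rV n.+1]_x
    (h x `^ n.+1%:R^-1 * \prod_i (line_integral (g i) i x `^ n.+1%:R^-1)) <=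
  (\int[lebesgue_rV n.+1]_x h x) `^ n.+1%:R^-1 *
  \prod_i (\int[lebesgue_rV n.+1]_x g i x) `^ n.+1%:R^-1.
Proof.
elim: n h g => [|n IH] h g h0 mh g0 mg.
  have i0 : 0 <= \int[lebesgue_rV 1]_x g ord0 x by exact: integral_ge0.
  rewrite big_ord1 invr1 !poweRe1 ?integral_ge0// -ge0_integralZr//.
  rewrite le_eqVlt; apply/orP; left; apply/eqP/eq_integral => x _.
  rewrite big_ord1 !poweRe1 ?line_integral_ge0//.
  by rewrite (ge0_integral_rV1 x).
have a01 : (0 < (n.+2%:R^-1 : R) < 1)%R.
  by rewrite invr_gt0 ltr0n invf_lt1 ?ltr0n// ltr1n.
have E : (n.+1%:R^-1 * (1 - n.+2%:R^-1) = n.+2%:R^-1 :> R)%R.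
  exact: (inv_succ_conjugate R n).
set a : R := n.+2%:R^-1%R in a01 E *; set b : R := n.+1%:R^-1%R in IH E.
pose L (z : 'rV[R]_n.+1) := \int[lebesgue_measure]_t g ord0 (rV_cons (t, z)).
have L0 z : 0 <= L z by exact: integral_ge0.
have mL : measurable_fun [set: 'rV[R]_n.+1] L.
  apply: (@measurable_fun_fubini_tonelli_G _ _ _ _ _ lebesgue_measure
    (g ord0 \o @rV_cons R n.+1)).
    by apply: measurableT_comp => //; exact: measurable_rV_cons.
  by move=> z; exact: g0.
have iL : \int[lebesgue_rV n.+1]_z L z = \int[lebesgue_rV n.+2]_x g ord0 x.
  by rewrite (ge0_integral_rV_cons_swap (f := g ord0)).
(* h takes the place of the first direction among the n + 2 functions of y *)
pose F (k : 'I_n.+2) (y : measurableTypeR R) :=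
  \int[lebesgue_rV n.+1]_z
    (if unlift ord0 k is Some i then g k (rV_cons (y, z)) else h (rV_cons (y, z))).
have F_ge0 k y : 0 <= F k y.
  by apply: integral_ge0 => z _; case: unlift.
have mF k : measurable_fun setT (F k).
  by rewrite /F; case: unlift => [i|]; exact: measurable_integral_rV_cons.
have Fh y : F ord0 y = \int[lebesgue_rV n.+1]_z h (rV_cons (y, z)).
  by rewrite /F unlift_none.
have Fg i y : F (lift ord0 i) y =
    \int[lebesgue_rV n.+1]_z g (lift ord0 i) (rV_cons (y, z)).
  by rewrite /F liftK.
have mI i : measurable_fun [set: 'rV[R]_n.+2]
    (fun x => line_integral (g i) i x `^ a).
  apply: (measurableT_comp (measurable_poweR _)).
  exact: measurable_line_integral.
have prod_ge0 I r (P : pred I) (f : I -> \bar R) c :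
    0 <= \prod_(i <- r | P i) (f i `^ c).
  by apply: prode_ge0 => i _; exact: poweR_ge0.
rewrite ge0_integral_rV_cons; last 2 first.
- by move=> x; rewrite mule_ge0 ?poweR_ge0.
- apply: emeasurable_funM; last exact: emeasurable_prod.
  exact: (measurableT_comp (measurable_poweR _)).
apply: (@le_trans _ _ (\int[lebesgue_measure]_y
    ((\int[lebesgue_rV n.+2]_x g ord0 x) `^ a * \prod_k (F k y `^ a)))).
  apply: ge0_le_integral => //.
  - by move=> y _; apply: integral_ge0 => z _; rewrite mule_ge0 ?poweR_ge0.
  - apply: (@measurable_integral_rV_cons _ n.+1
      (fun x => h x `^ a * \prod_i (line_integral (g i) i x `^ a))).
      by move=> x; rewrite mule_ge0 ?poweR_ge0.
    apply: emeasurable_funM; last exact: emeasurable_prod.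
    exact: (measurableT_comp (measurable_poweR _)).
  - apply: emeasurable_funM => //; apply: emeasurable_prod => k.
    exact: (measurableT_comp (measurable_poweR _)).
  move=> y _.
  pose G z := h (rV_cons (y, z)) `^ b *
    \prod_i (line_integral (fun z => g (lift ord0 i) (rV_cons (y, z))) i z `^ b).
  have G0 z : 0 <= G z by rewrite mule_ge0 ?poweR_ge0.
  have mG : measurable_fun setT G.
    apply: emeasurable_funM.
      apply: (measurableT_comp (measurable_poweR _)).
      exact: measurable_rV_cons_section.
    apply: emeasurable_prod => i; apply: (measurableT_comp (measurable_poweR _)).
    apply: measurable_line_integral => //; exact: measurable_rV_cons_section.
  rewrite (_ : integral _ _ _ =
      \int[lebesgue_rV n.+1]_z (L z `^ a * G z `^ (1 - a))); last first.
    apply: eq_integral => z _; rewrite big_ord_recl muleCA; congr (_ * _).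
      congr (_ `^ _); apply: eq_integral => t _.
      by rewrite set_coord_cons0.
    rewrite poweRM ?poweR_ge0// -poweRrM E; congr (_ * _).
    rewrite prode_poweR; last by move=> i; exact: poweR_ge0.
    apply: eq_bigr => i _; rewrite -poweRrM E; congr (_ `^ _).
    by apply: eq_integral => t _; rewrite set_coord_cons.
  apply: (le_trans (ge0_hoelder _ a01 mL mG L0 G0)).
  rewrite iL; apply: lee_wpmul2l; first exact: poweR_ge0.
  apply: (@le_trans _ _ (((\int[lebesgue_rV n.+1]_z h (rV_cons (y, z))) `^ b *
      \prod_i (\int[lebesgue_rV n.+1]_z g (lift ord0 i) (rV_cons (y, z))) `^ b)
      `^ (1 - a))).
    apply: gt0_ler_poweR; rewrite ?in_itv/= ?leey ?andbT.
    - by rewrite subr_ge0 ltW//; case/andP: a01.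
    - exact: integral_ge0.
    - by rewrite mule_ge0 ?poweR_ge0.
    - apply: IH => // [|i]; exact: measurable_rV_cons_section.
  rewrite poweRM ?poweR_ge0// -poweRrM E prode_poweR; last first.
    by move=> i; exact: poweR_ge0.
  rewrite [leRHS]big_ord_recl Fh; apply: lee_wpmul2l; first exact: poweR_ge0.
  rewrite le_eqVlt; apply/orP; left; apply/eqP; apply: eq_bigr => i _.
  by rewrite -poweRrM E Fg.
rewrite ge0_integralZl//; last 2 first.
- apply: emeasurable_prod => k.
  exact: (measurableT_comp (measurable_poweR _)).
- exact: poweR_ge0.
rewrite big_ord_recl muleCA; apply: lee_wpmul2l; first exact: poweR_ge0.
apply: (le_trans (ge0_hoelder_prod _ mF F_ge0)).
rewrite [leLHS]big_ord_recl !ge0_integral_rV_cons//.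
rewrite (eq_integral _ _ (fun y _ => Fh y)).
apply: lee_wpmul2l; first exact: poweR_ge0.
rewrite le_eqVlt; apply/orP; left; apply/eqP; apply: eq_bigr => i _.
by rewrite ge0_integral_rV_cons// (eq_integral _ _ (fun y _ => Fg i y)).
Qed.

End gagliardo.

(** * Powers of a differentiable function of one variable *)

Section abs_power.
Context {R : realType}.
Implicit Types (s t g : R).

Lemma norm_powR_lt_near0 (c e : R) : 0 < c -> 0 < e ->
  \forall s \near (0 : R), `|s| `^ c < e.
Proof.
move=> c0 e0; apply/nbhs_ballP; exists (e `^ c^-1) => /=.
  by rewrite powR_gt0.
move=> s; rewrite /ball/= sub0r normrN => se.
have := gt0_ltr_powR c0 (_ : `|s| \in Num.nneg) (_ : e `^ c^-1 \in Num.nneg) se.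
by rewrite -powRrM mulVf ?gt_eqF// powRr1 ?ltW//; apply; rewrite nnegrE ?powR_ge0.
Qed.

(** The derivative of |s|^g, written through (s^2)^(g/2): this single formula
    covers both signs of s. *)
Definition dabspow g s : R := g * s * (s ^+ 2) `^ (g / 2 - 1).

Lemma abspowE g s : (s ^+ 2) `^ (g / 2) = `|s| `^ g.
Proof.
rewrite -real_normK ?num_real// -powR_mulrn// -powRrM.
by congr (_ `^ _); field.
Qed.

Lemma norm_dabspow g s : 1 < g -> `|dabspow g s| = g * `|s| `^ (g - 1).
Proof.
move=> g1; have g0 : 0 < g by exact: lt_trans ltr01 g1.
have [->|s0] := eqVneq s 0.
  by rewrite /dabspow mulr0 mul0r normr0 powR0 ?mulr0// subr_eq0 gt_eqF.
rewrite /dabspow (_ : g / 2 - 1 = (g - 2) / 2); last by field.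
rewrite abspowE !normrM (ger0_norm (ltW g0)) (ger0_norm (powR_ge0 _ _)).
rewrite -mulrA; congr (_ * _).
rewrite -[in RHS](@mulr_powRB1 _ `|s| (g - 1)) ?subr_gt0//; congr (_ * _ `^ _).
by ring.
Qed.

(** Away from 0 this is the chain rule for (s^2)^(g/2); at 0 the difference
    quotient has absolute value |h|^(g - 1), which tends to 0 as g > 1. *)
Lemma is_derive_abspow g s : 1 < g ->
  is_derive s 1 (fun s => `|s| `^ g) (dabspow g s).
Proof.
move=> g1; have g0 : 0 < g by exact: lt_trans ltr01 g1.
have [->|s0] := eqVneq s 0.
  have h : (fun h : R => h^-1 *: (((fun t : R => `|t| `^ g) \o shift (0 : R))
      (h *: (1 : R)) - `|0 : R| `^ g)) @ 0^' --> (0 : R).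
    apply/cvgr0Pnorm_lt => e e0.
    have g10 : 0 < g - 1 by rewrite subr_gt0.
    have := norm_powR_lt_near0 g10 e0 => he.
    near=> h.
    have h0 : h != 0 by near: h; exact: nbhs_dnbhs_neq.
    rewrite /= normr0 powR0 ?gt_eqF// subr0 addr0 [h *: _]mulr1.
    rewrite normrZ (ger0_norm (powR_ge0 _ _)) normfV.
    rewrite -(mulr_powRB1 (normr_ge0 h) g0) mulrA mulVf ?normr_eq0// mul1r.
    by near: h; exact: nbhs_dnbhs he.
  have -> : dabspow g 0 = 0 by rewrite /dabspow mulr0 mul0r.
  by split; [apply/cvg_ex; exists 0|exact: (cvg_lim _ h)].
have -> : (fun s => `|s| `^ g) = (fun s => (s ^+ 2) `^ (g / 2)).
  by apply/funext => t; rewrite abspowE.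
have s20 : 0 < s ^+ 2 by rewrite exprn_even_gt0.
have d1 := is_derive1_powR (g / 2) s20.
have d2 : is_derive s 1 (fun s : R => s ^+ 2) (2 * s).
  have := @is_deriveX R _ id 2 s 1 1 (is_derive_id _ _).
  by rewrite /= expr1 [_ *: _]mulr1.
rewrite (_ : dabspow g s = g / 2 * (s ^+ 2) `^ (g / 2 - 1) * (2 * s)).
  exact: (@is_derive1_comp R (@powR R ^~ (g / 2)) (fun t => t ^+ 2) s _ _ d1 d2).
by rewrite /dabspow; field.
Unshelve. all: by end_near.
Qed.

Lemma continuous_dabspow g : 1 < g -> continuous (dabspow g).
Proof.
move=> g1 s; have g0 : 0 < g by exact: lt_trans ltr01 g1.
have [->|s0] := eqVneq s 0.
  rewrite /continuous_at (_ : dabspow g 0 = 0); last by rewrite /dabspow mulr0 mul0r.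
  apply/cvgr0Pnorm_lt => e e0.
  have g10 : 0 < g - 1 by rewrite subr_gt0.
  have := norm_powR_lt_near0 g10 (divr_gt0 e0 g0); apply: filterS => t.
  by rewrite norm_dabspow// ltr_pdivlMr// mulrC.
apply: cvgM; first by apply: cvgM; [exact: cvg_cst|exact: cvg_id].
have s20 : 0 < s ^+ 2 by rewrite exprn_even_gt0.
apply: (@continuous_comp _ _ _ (fun t : R => t ^+ 2) (fun t => t `^ (g / 2 - 1))).
  exact: exprn_continuous.
apply: differentiable_continuous; apply/derivable1_diffP.
exact: (@ex_derive _ _ _ _ _ _ _ (is_derive1_powR _ s20)).
Qed.

Local Notation mu := lebesgue_measure.

(** The fundamental theorem of calculus for |F|^g between the zero a of F and x. *)
Lemma norm_powR_le_integral (F F' : R -> R) g a x : 1 < g -> a < x -> F a = 0 ->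
  (forall t, is_derive t 1 F (F' t)) -> continuous F' ->
  ((`|F x| `^ g)%:E <= \int[mu]_t (g * `|F t| `^ (g - 1) * `|F' t|)%:E)%E.
Proof.
move=> g1 ax Fa dF cF'; have g0 : 0 < g by exact: lt_trans ltr01 g1.
have cF : continuous F.
  move=> t; apply: differentiable_continuous; apply/derivable1_diffP.
  exact: (@ex_derive _ _ _ _ _ _ _ (dF t)).
pose G' t := dabspow g (F t) * F' t.
have dG t : is_derive t 1 (fun t => `|F t| `^ g) (G' t).
  exact: (is_derive1_comp (is_derive_abspow (F t) g1) (dF t)).
have cG' : continuous G'.
  move=> t; apply: cvgM; last exact: cF'.
  by apply: continuous_comp; [exact: cF|exact: continuous_dabspow].
have cG : continuous (fun t => `|F t| `^ g).
  move=> t; apply: differentiable_continuous; apply/derivable1_diffP.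
  exact: (@ex_derive _ _ _ _ _ _ _ (dG t)).
have nG' t : `|G' t| = g * `|F t| `^ (g - 1) * `|F' t|.
  by rewrite normrM norm_dabspow.
have mG' : measurable_fun [set: R] G' by exact: continuous_measurable_fun.
have FTC : (\int[mu]_(t in `[a, x]) (G' t)%:E = (`|F x| `^ g)%:E)%E.
  rewrite (@continuous_FTC2 _ _ (fun t => `|F t| `^ g))//.
  - by rewrite Fa normr0 powR0 ?gt_eqF// sube0.
  - exact: continuous_subspaceT.
  - split=> [t _||]; first exact: (@ex_derive _ _ _ _ _ _ _ (dG t)).
    + by apply: cvg_at_right_filter; exact: cG.
    + by apply: cvg_at_left_filter; exact: cG.
  - by move=> t _; rewrite derive1E; exact: (@derive_val _ _ _ _ _ _ _ (dG t)).
rewrite -FTC; apply: (le_trans (lee_abs _)).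
apply: (le_trans (le_abse_integral _ _ _)) => //.
  by apply/measurable_EFinP; exact: measurable_funTS.
under [leRHS]eq_integral => t _ do rewrite -nG'.
apply: ge0_subset_integral => //.
by apply/measurable_EFinP; exact: measurableT_comp.
Qed.

End abs_power.

(** * Bounded domains and test functions *)

Section bounded_domain.
Context {R : realType} {n : nat}.
Implicit Types (Omega : set 'rV[R]_n) (f : 'rV[R]_n -> R).

Lemma bounded_set_coord Omega : bounded_set Omega ->
  exists2 M : R, 0 < M & forall x, Omega x -> forall i, `|x ord0 i| < M.
Proof.
move=> /ex_strict_bound_gt0[M M0 OmegaM]; exists M => // x /OmegaM /= xM i.
have : ball (0 : 'rV[R]_n) M x by rewrite mx_norm_ball /ball_/= sub0r normrN.
by move=> [_ /(_ ord0 i)]; rewrite mxE /ball/= sub0r normrN.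
Qed.

Lemma bounded_set_lebesgue_lty Omega :
  measurable Omega -> bounded_set Omega -> (lebesgue_rV n Omega < +oo)%E.
Proof.
move=> mO /bounded_set_coord[M M0 OM].
have mI (i : 'I_n) : measurable (`]- M, M[%classic : set (measurableTypeR R)).
  exact: measurable_itv.
pose box := [set x : 'rV[R]_n | forall i, `]- M, M[%classic (x ord0 i)].
have : (lebesgue_rV n box < +oo)%E.
  rewrite (lebesgue_rV_box (A := fun=> `]- M, M[%classic))//.
  rewrite ltey_eq; apply/orP; left; apply: prode_fin_num => i _.
  by rewrite lebesgue_measure_itv/=; case: ifP.
apply: le_lt_trans; apply: le_measure; rewrite ?inE//.
  exact: (@measurable_rV_box R n (fun=> `]- M, M[%classic)).
by move=> x /OM xM i /=; rewrite in_itv/= -ltr_norml.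
Qed.

Lemma set_coord_id (x : 'rV[R]_n) i : set_coord x i (x ord0 i) = x.
Proof. by apply/rowP => j; rewrite mxE; case: eqP => // ->. Qed.

Lemma set_coordE (x : 'rV[R]_n) i t :
  set_coord x i t = set_coord x i 0 + t *: delta_mx ord0 i.
Proof.
apply/rowP => j; rewrite !mxE eqxx/=.
by case: eqP => _; rewrite ?mulr1 ?mulr0 ?add0r ?addr0.
Qed.

Lemma continuous_set_coord (x : 'rV[R]_n) i : continuous (set_coord x i).
Proof.
have -> : set_coord x i = fun t => set_coord x i 0 + t *: delta_mx ord0 i.
  by apply/funext => t; exact: set_coordE.
move=> t; apply: cvgD; first exact: cvg_cst.
by apply: cvgZr_tmp; exact: cvg_id.
Qed.

Lemma is_derive_set_coord f x i t :
  derivable f (set_coord x i t) (delta_mx ord0 i) ->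
  is_derive t 1 (fun t => f (set_coord x i t)) (partial i f (set_coord x i t)).
Proof.
move=> df.
have E : (fun h : R => h^-1 *: (((fun t => f (set_coord x i t)) \o shift t) (h *: (1 : R))
      - f (set_coord x i t))) =
    (fun h => h^-1 *: ((f \o shift (set_coord x i t)) (h *: delta_mx ord0 i)
      - f (set_coord x i t))).
  apply/funext => h /=; congr (_ *: (f _ - _)).
  rewrite set_coordE [in RHS]set_coordE [h *: (1 : R)]mulr1.
  by rewrite scalerDl addrCA.
by split; rewrite /derivable /partial /derive E.
Qed.

End bounded_domain.

Section test_function.
Context {R : realType} {n : nat}.
Variables (Omega : set 'rV[R]_n) (phi : 'rV[R]_n -> R).
Hypothesis tphi : test_function Omega phi.

Lemma test_continuous : continuous phi.
Proof. by case: tphi => /(_ 0). Qed.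

Lemma test_derivable i x : derivable phi x (delta_mx ord0 i).
Proof. by case: tphi => /(_ 1)[_ /(_ i)[]]. Qed.

Lemma test_partial_continuous i : continuous (partial i phi).
Proof. by case: tphi => /(_ 1)[_ /(_ i)[]]. Qed.

Lemma test_out x : ~ Omega x -> phi x = 0.
Proof.
move=> nOx; apply/eqP; apply: contra_notT nOx => px.
by case: tphi => _ _; apply; exact: subset_closure.
Qed.

Lemma test_bounded : exists2 M : R, 0 < M & forall x, `|phi x| < M.
Proof.
case: tphi => _ cK _.
have cphiK : compact (phi @` closure [set x | phi x != 0]).
  apply: continuous_compact => //; apply: continuous_subspaceT.
  exact: test_continuous.
have /ex_strict_bound_gt0[M M0 phiM] := compact_bounded cphiK.
exists M => // x; have [->|px] := eqVneq (phi x) 0; first by rewrite normr0.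
by apply: phiM; exists x => //; exact: subset_closure.
Qed.

End test_function.

(** * The Sobolev inequality for test functions *)

Section exponents.
Context {R : realType}.
Implicit Types p d : R.

Definition sobolev_exponent p d : R := p * d / (d - p).

Definition chain_exponent p d : R := p * (d - 1) / (d - p).

Variables (p d : R).
Hypotheses (p1 : 1 < p) (pd : p < d).

Let p0 : 0 < p. Proof. exact: lt_trans ltr01 p1. Qed.
Let d0 : 0 < d. Proof. exact: lt_trans p0 pd. Qed.
Let dp0 : 0 < d - p. Proof. by rewrite subr_gt0. Qed.

Lemma sobolev_exponent_gt : p < sobolev_exponent p d.
Proof.
rewrite /sobolev_exponent ltr_pdivlMr// ltr_pM2l//.
by rewrite ltrBlDr ltrDl.
Qed.

Lemma sobolev_exponent_gt0 : 0 < sobolev_exponent p d.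
Proof. exact: lt_trans p0 sobolev_exponent_gt. Qed.

Lemma chain_exponent_gt1 : 1 < chain_exponent p d.
Proof.
rewrite /chain_exponent ltr_pdivlMr// mul1r mulrBr mulr1 ltr_leB//.
by rewrite ltr_pMl.
Qed.

(** This identity fixes the choice of the chain exponent gamma: with
    h = |phi|^s one has h^(1/d) |phi|^gamma = |phi|^s. *)
Lemma sobolev_chain :
  sobolev_exponent p d * d^-1 + chain_exponent p d = sobolev_exponent p d.
Proof.
by rewrite /sobolev_exponent /chain_exponent; field; rewrite !gt_eqF.
Qed.

(** Hoelder's inequality applied to |phi|^(gamma - 1) |d_i phi| reproduces the
    integral of |phi|^s. *)
Lemma sobolev_chain_pred :
  sobolev_exponent p d * (1 - p^-1) = chain_exponent p d - 1.
Proof.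
by rewrite /sobolev_exponent /chain_exponent; field; rewrite !gt_eqF.
Qed.

Lemma sobolev_exponentV : (sobolev_exponent p d)^-1 = p^-1 - d^-1.
Proof. by rewrite /sobolev_exponent; field; rewrite !gt_eqF. Qed.

(** The powers of Y on the right add up to 1 - 1/s, so dividing bounds Y^(1/s). *)
Lemma sobolev_absorb (Y c D : R) : 0 <= Y -> 0 <= c -> 0 <= D ->
  Y <= Y `^ d^-1 * (c * Y `^ (1 - p^-1) * D `^ p^-1) ->
  Y <= c `^ sobolev_exponent p d * D `^ (sobolev_exponent p d / p).
Proof.
move=> Y0 c0 D0; have [->|Ynz] := eqVneq Y 0.
  by move=> _; rewrite mulr_ge0 ?powR_ge0.
have Yp : 0 < Y by rewrite lt0r Ynz.
have s0 := sobolev_exponent_gt0; set s := sobolev_exponent p d in s0 *.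
have -> : Y `^ d^-1 * (c * Y `^ (1 - p^-1) * D `^ p^-1) =
    Y `^ (1 - s^-1) * (c * D `^ p^-1).
  rewrite (mulrC c) -mulrA mulrA -powRD ?Ynz ?implybT//.
  by congr (_ `^ _ * _); rewrite /s sobolev_exponentV; ring.
move=> h; have {h} : Y `^ s^-1 <= c * D `^ p^-1.
  rewrite -(ler_pM2l (powR_gt0 (1 - s^-1) Yp)) -powRD ?Ynz ?implybT//.
  by rewrite subrK powRr1.
move=> /(@ge0_ler_powR _ s (ltW s0)); rewrite !nnegrE powR_ge0 => /(_ isT).
rewrite mulr_ge0 ?powR_ge0// => /(_ isT).
by rewrite -powRrM mulVf ?gt_eqF// powRr1// powRM ?powR_ge0// -powRrM (mulrC p^-1).
Qed.

End exponents.

Lemma prode_cst_poweR (R : realType) n (c : \bar R) :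
  (0 <= c -> \prod_(i < n.+1) (c `^ n.+1%:R^-1) = c)%E.
Proof.
move=> c0; have [->|cnz] := eqVneq c 0%E.
  by rewrite big_ord_recl poweR0r ?mul0e// invr_neq0// pnatr_eq0.
have H (a : R) : 0 <= a -> forall m, (\prod_(i < m) (c `^ a) = c `^ (m%:R * a))%E.
  move=> a0; elim=> [|m IH]; first by rewrite big_ord0 mul0r poweRe0.
  rewrite big_ord_recl IH -poweRD; last by rewrite nneg_neq0_poweRD_def// mulr_ge0.
  by rewrite -[X in X + _]mul1r -mulrDl -natr1 addrC.
by rewrite H ?invr_ge0// divff ?pnatr_eq0// poweRe1.
Qed.

Section sobolev_test.
Context {R : realType} {n : nat}.
Variables (p : R) (Omega : set 'rV[R]_n.+1) (phi : 'rV[R]_n.+1 -> R).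
Hypotheses (p1 : 1 < p) (pd : p < n.+1%:R).
Hypotheses (oOmega : open Omega) (bOmega : bounded_set Omega).
Hypothesis tphi : test_function Omega phi.

Local Notation mu := (lebesgue_rV n.+1).
Let s := sobolev_exponent p n.+1%:R.
Let g := chain_exponent p n.+1%:R.
Let mOmega : measurable Omega. Proof. exact: open_measurable_rV. Qed.

(** On each line parallel to an axis phi vanishes far enough out, Omega being
    bounded. *)
Lemma test_norm_powR_le_line_integral i x :
  ((`|phi x| `^ g)%:E <= line_integral
    (fun y => (g * `|phi y| `^ (g - 1) * `|partial i phi y|)%:E) i x)%E.
Proof.
have [M M0 OM] := bounded_set_coord bOmega.
(* a point of the line to the left of x and outside the cube containing Omega *)
pose a := - (`|x ord0 i| + M).
have ax : a < x ord0 i.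
  rewrite /a ltrNl (le_lt_trans (ler_norm _))// normrN ltrDl//.
have phia : phi (set_coord x i a) = 0.
  apply: (test_out tphi) => /OM /(_ i); rewrite mxE eqxx /a normrN ger0_norm.
    by rewrite ltNge lerDr normr_ge0.
  by rewrite addr_ge0 ?normr_ge0// ltW.
rewrite -{1}(set_coord_id x i).
apply: (@norm_powR_le_integral _ (fun t => phi (set_coord x i t))
  (fun t => partial i phi (set_coord x i t)) g a _ _ ax phia).
- exact: chain_exponent_gt1.
- by move=> t; apply: is_derive_set_coord; exact: test_derivable tphi _ _.
- move=> t; apply: continuous_comp; first exact: continuous_set_coord.
  exact: (test_partial_continuous tphi).
Qed.

Lemma partial_le_enorm i x : `|partial i phi x| <= enorm (gradient phi x).
Proof.
rewrite -sqrtr_sqr /enorm ler_sqrt; last by apply: sumr_ge0 => j _; exact: sqr_ge0.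
rewrite (bigD1 i)//= mxE lerDl; apply: sumr_ge0 => j _; exact: sqr_ge0.
Qed.

Lemma measurable_enorm (D : set 'rV[R]_n.+1) (v : 'rV[R]_n.+1 -> 'rV[R]_n.+1) :
  (forall i, measurable_fun D (fun x => v x ord0 i)) ->
  measurable_fun D (fun x => enorm (v x)).
Proof.
have msqrt : measurable_fun [set: R] (@Num.sqrt R).
  by apply: continuous_measurable_fun; exact: sqrt_continuous.
move=> mv; apply: (measurableT_comp msqrt).
by apply: measurable_sum => i; apply: measurable_funX.
Qed.

Let measurable_gradient : measurable_fun [set: 'rV[R]_n.+1]
  (fun x => enorm (gradient phi x)).
Proof.
apply: measurable_enorm => i; under eq_fun do rewrite mxE.
by apply: continuous_measurable_rV; exact: (test_partial_continuous tphi).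
Qed.

Let mphi : measurable_fun [set: 'rV[R]_n.+1] phi.
Proof. by apply: continuous_measurable_rV; exact: (test_continuous tphi). Qed.

Let mphi_pow (c : R) : measurable_fun [set: 'rV[R]_n.+1] (fun x => (`|phi x| `^ c)%:E).
Proof. exact: measurable_EFin_norm_powR mphi. Qed.

Lemma test_integral_powR (c : R) : 0 < c ->
  (\int[mu]_x (`|phi x| `^ c)%:E = \int[mu]_(x in Omega) (`|phi x| `^ c)%:E)%E.
Proof.
move=> c0; rewrite [RHS]integral_mkcond; apply: eq_integral => x _.
rewrite patchE; case: ifPn => // /negP; rewrite inE => /(test_out tphi) ->.
by rewrite normr0 powR0 ?gt_eqF.
Qed.

(** Finiteness is what allows sobolev_absorb to divide by a power of the integral. *)
Lemma test_integral_powR_lty (c : R) : 0 < c -> (\int[mu]_x (`|phi x| `^ c)%:E < +oo)%E.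
Proof.
move=> c0; rewrite test_integral_powR//; have [M M0 phiM] := test_bounded tphi.
apply: (@le_lt_trans _ _ (\int[mu]_(x in Omega) cst (M `^ c)%:E x)%E).
  apply: ge0_le_integral => //.
  - exact: (measurable_funTS (mphi_pow c)).
  - by move=> x _; rewrite lee_fin; apply: ge0_ler_powR;
      rewrite ?nnegrE ?normr_ge0//; apply: ltW.
rewrite integral_cst// lte_mul_pinfty ?lee_fin ?powR_ge0//.
exact: bounded_set_lebesgue_lty.
Qed.

(** Hoelder's inequality with exponents p / (p - 1) and p.  The integrand on the
    left vanishes outside Omega because gamma > 1, so the gradient matters only
    in Omega. *)
Lemma test_integral_chain i :
  (\int[mu]_x (g * `|phi x| `^ (g - 1) * `|partial i phi x|)%:E <=
   g%:E * (\int[mu]_x (`|phi x| `^ s)%:E) `^ (1 - p^-1) *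
   (\int[mu]_(x in Omega) (enorm (gradient phi x) `^ p)%:E) `^ p^-1)%E.
Proof.
have p0 : 0 < p by exact: lt_trans ltr01 p1.
have g1 : 1 < g by exact: chain_exponent_gt1.
have g0 : 0 < g by exact: lt_trans ltr01 g1.
have a01 : 0 < 1 - p^-1 < 1.
  by rewrite subr_gt0 invf_lt1// p1 ltrBlDr ltrDl invr_gt0.
(* extended by 0, so that Hoelder applies on the whole space *)
pose D := (fun x => (enorm (gradient phi x) `^ p)%:E) \_ Omega.
have D0 x : (0 <= D x)%E.
  by rewrite /D patchE; case: ifP => // _; rewrite lee_fin powR_ge0.
have mD : measurable_fun [set: 'rV[R]_n.+1] D.
  apply/(measurable_restrictT _ mOmega); apply: measurable_EFin_powR.
  exact: measurable_funTS measurable_gradient.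
have F0 x : (0 <= (`|phi x| `^ s)%:E)%E by rewrite lee_fin powR_ge0.
have mFD : measurable_fun [set: 'rV[R]_n.+1]
    (fun x => (`|phi x| `^ s)%:E `^ (1 - p^-1) * D x `^ p^-1)%E.
  by apply: emeasurable_funM; apply: (measurableT_comp (measurable_poweR _)).
have := ge0_hoelder mu a01 (mphi_pow s) mD F0 D0.
rewrite subKr -integral_mkcond => H.
rewrite -muleA; apply: le_trans (lee_wpmul2l _ H); last by rewrite lee_fin ltW.
rewrite -ge0_integralZl//; last 2 first.
- by move=> x _; rewrite mule_ge0 ?poweR_ge0.
- by rewrite lee_fin ltW.
apply: ge0_le_integral => //.
- by move=> x _; rewrite lee_fin; apply: mulr_ge0 => //; apply: mulr_ge0;
    rewrite ?powR_ge0 ?(ltW g0).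
- apply/measurable_EFinP; apply: measurable_funM.
    apply: measurable_funM => //; apply/measurable_EFinP; exact: mphi_pow.
  apply: measurableT_comp => //.
  by apply: continuous_measurable_rV; exact: (test_partial_continuous tphi).
- exact: emeasurable_funM.
move=> x _; rewrite /D patchE; case: ifPn => [_|/negP].
  rewrite -EFinM lee_fin -mulrA; apply: ler_wpM2l; first exact: ltW.
  rewrite -!powRrM (sobolev_chain_pred p1 pd) divff ?gt_eqF// powRr1 ?sqrtr_ge0//.
  apply: ler_wpM2l; first exact: powR_ge0.
  exact: partial_le_enorm.
rewrite inE => /(test_out tphi) ->.
rewrite normr0 [_ `^ (g - 1)]powR0 ?mulr0 ?mul0r.
  by rewrite !mule_ge0 ?poweR_ge0// lee_fin ltW.
by rewrite subr_eq0 gt_eqF.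
Qed.

Lemma sobolev_test_function :
  (\int[mu]_(x in Omega) (`|phi x| `^ s)%:E <=
   (g `^ s)%:E *
   (\int[mu]_(x in Omega) (enorm (gradient phi x) `^ p)%:E) `^ (s / p))%E.
Proof.
have p0 : 0 < p by exact: lt_trans ltr01 p1.
have g0 : 0 < g by exact: lt_trans ltr01 (chain_exponent_gt1 _ _).
have s0 : 0 < s by exact: sobolev_exponent_gt0.
rewrite -test_integral_powR//; have := test_integral_powR_lty s0.
set Y := (\int[mu]_x _)%E; set D := (\int[mu]_(x in Omega) _)%E.
have Y0 : (0 <= Y)%E by apply: integral_ge0 => x _; rewrite lee_fin powR_ge0.
have D0 : (0 <= D)%E by apply: integral_ge0 => x _; rewrite lee_fin powR_ge0.
pose G i x := (g * `|phi x| `^ (g - 1) * `|partial i phi x|)%:E.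
have G0 i x : (0 <= G i x)%E.
  by rewrite lee_fin; apply: mulr_ge0 => //; apply: mulr_ge0;
    rewrite ?powR_ge0 ?(ltW g0).
have mG i : measurable_fun [set: 'rV[R]_n.+1] (G i).
  apply/measurable_EFinP; apply: measurable_funM.
    apply: measurable_funM => //; apply/measurable_EFinP; exact: mphi_pow.
  apply: measurableT_comp => //.
  by apply: continuous_measurable_rV; exact: (test_partial_continuous tphi).
have F0 x : (0 <= (`|phi x| `^ s)%:E)%E by rewrite lee_fin powR_ge0.
have key : (Y <= Y `^ n.+1%:R^-1 *
    (g%:E * Y `^ (1 - p^-1) * D `^ p^-1))%E.
  apply: (@le_trans _ _ (Y `^ n.+1%:R^-1 *
    \prod_(i < n.+1) (\int[mu]_x G i x) `^ n.+1%:R^-1)%E); last first.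
    apply: lee_wpmul2l; first exact: poweR_ge0.
    rewrite -[leRHS](@prode_cst_poweR R n); last by rewrite !mule_ge0 ?poweR_ge0// lee_fin ltW.
    apply: le_prode => i; rewrite poweR_ge0 andTb.
    apply: gt0_ler_poweR; rewrite ?invr_ge0// ?in_itv/= ?leey ?andbT.
    + exact: integral_ge0.
    + by rewrite !mule_ge0 ?poweR_ge0// lee_fin ltW.
    + exact: test_integral_chain.
  apply: le_trans (ge0_integral_line_integrals F0 (mphi_pow s) G0 mG).
  apply: ge0_le_integral => //.
  - apply: emeasurable_funM; first by apply: (measurableT_comp (measurable_poweR _)).
    apply: emeasurable_prod => i; apply: (measurableT_comp (measurable_poweR _)).
    exact: measurable_line_integral.
  move=> x _; apply: (@le_trans _ _ ((`|phi x| `^ s)%:E `^ n.+1%:R^-1 *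
    \prod_(i < n.+1) ((`|phi x| `^ g)%:E `^ n.+1%:R^-1))%E); last first.
    apply: lee_wpmul2l; first exact: poweR_ge0.
    apply: le_prode => i; rewrite poweR_ge0 andTb.
    apply: gt0_ler_poweR; rewrite ?invr_ge0// ?in_itv/= ?leey ?andbT ?lee_fin ?powR_ge0//.
    + by apply: line_integral_ge0 => y; exact: G0.
    + exact: test_norm_powR_le_line_integral.
  rewrite prode_cst_poweR ?lee_fin ?powR_ge0// -powRrM -powRD.
    by rewrite (sobolev_chain p1 pd).
  by rewrite (sobolev_chain p1 pd) gt_eqF.
move: Y0 D0 key; case: Y => [y| |]//; case: D => [d| |]//.
- rewrite !lee_fin => y0 d0 key _; apply: sobolev_absorb => //; exact: ltW.
- move=> _ _ _ _; rewrite poweRyr; last by rewrite gt_eqF; last exact: divr_gt0.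
  by rewrite gt0_muley ?leey// lte_fin powR_gt0.
Qed.

End sobolev_test.

(** * The Sobolev inequality on W_0^{1,p} *)

Section pointwise.
Context {R : realType}.

(** Either |b - a| <= |b|, and then |a| <= 2 |b|; or |a| <= 2 |b - a|, and the
    truncation trades the power s for the power p.  This replaces the extraction
    of an almost everywhere convergent subsequence: convergence in L^p of test
    functions b to a controls the s-th power of the truncation of a. *)
Lemma truncation_le_powR (p s a b M : R) : 0 < p -> p <= s -> 0 <= M ->
  Num.min `|a| M `^ s <=
  2 `^ s * `|b| `^ s + M `^ (s - p) * 2 `^ p * `|b - a| `^ p.
Proof.
move=> p0 ps M0; have s0 : 0 < s by exact: lt_le_trans ps.
have m0 : 0 <= Num.min `|a| M by rewrite le_min normr_ge0.
have [ab|/ltW ab] := leP `|b - a| `|b|.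
  have le2b : Num.min `|a| M <= 2 * `|b|.
    rewrite ge_min; apply/orP; left.
    have := ler_distD b 0 a; rewrite !sub0r !normrN (distrC b) in ab *.
    by move: ab; rewrite distrC; lra.
  apply: ler_wpDr; first by rewrite !mulr_ge0 ?powR_ge0.
  by rewrite -powRM// ge0_ler_powR ?nnegrE ?mulr_ge0// ltW.
have le2d : Num.min `|a| M <= 2 * `|b - a|.
  rewrite ge_min; apply/orP; left.
  have := ler_distD b 0 a; rewrite !sub0r !normrN.
  by move: ab; lra.
apply: ler_wpDl; first by rewrite !mulr_ge0 ?powR_ge0.
have -> : Num.min `|a| M `^ s = Num.min `|a| M `^ (s - p) * Num.min `|a| M `^ p.
  by rewrite -powRD subrK// gt_eqF.
rewrite -mulrA -powRM//.
apply: ler_pM; rewrite ?powR_ge0//.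
  by apply: ge0_ler_powR; rewrite ?nnegrE ?subr_ge0// ge_min lexx orbT.
by apply: ge0_ler_powR; rewrite ?nnegrE ?mulr_ge0// ltW.
Qed.

(** Crude substitute for the triangle inequality; the constant does not matter. *)
Lemma enorm_powR_le n (p : R) (v w : 'rV[R]_n) : 0 < p ->
  enorm v `^ p <= 2 `^ p * (enorm w `^ p + enorm (v - w) `^ p).
Proof.
move=> p0; have e0 m (z : 'rV[R]_m) : 0 <= enorm z by exact: sqrtr_ge0.
have sq0 m (z : 'rV[R]_m) : 0 <= \sum_i z ord0 i ^+ 2.
  by apply: sumr_ge0 => i _; exact: sqr_ge0.
have sqE m (z : 'rV[R]_m) : enorm z ^+ 2 = \sum_i z ord0 i ^+ 2.
  by rewrite sqr_sqrtr.
have h2 : enorm v ^+ 2 <= 2 * (enorm w ^+ 2 + enorm (v - w) ^+ 2).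
  rewrite !sqE -big_split/= mulr_sumr; apply: ler_sum => i _; rewrite !mxE.
  by have := sqr_ge0 (v ord0 i - 2 * w ord0 i); nra.
have hmax : enorm v <= 2 * Num.max (enorm w) (enorm (v - w)).
  rewrite -(@ler_pXn2r _ 2) ?nnegrE ?mulr_ge0 ?le_max ?e0// exprMn.
  apply: (le_trans h2).
  have [h|h] := leP (enorm w) (enorm (v - w)).
    have : enorm w ^+ 2 <= enorm (v - w) ^+ 2 by rewrite ler_pXn2r ?nnegrE.
    by lra.
  have : enorm (v - w) ^+ 2 <= enorm w ^+ 2.
    by rewrite ler_pXn2r ?nnegrE ?e0// ltW.
  by lra.
apply: (@le_trans _ _ ((2 * Num.max (enorm w) (enorm (v - w))) `^ p)).
  by apply: ge0_ler_powR; rewrite ?nnegrE ?mulr_ge0 ?le_max ?e0// ltW.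
rewrite powRM// ?le_max ?e0//; apply: ler_wpM2l; first exact: powR_ge0.
have [_|_] := leP (enorm w) (enorm (v - w)).
  by rewrite lerDr powR_ge0.
by rewrite lerDl powR_ge0.
Qed.

End pointwise.

Lemma EFin_poweR_le (R : realType) (x : \bar R) (y a : R) :
  0 <= a -> (0 <= x)%E -> (x <= y%:E)%E -> (x `^ a <= (y `^ a)%:E)%E.
Proof.
move=> a0; case: x => [x| |]//; rewrite !lee_fin => x0 xy.
by apply: ge0_ler_powR; rewrite ?nnegrE// (le_trans x0).
Qed.

Section sobolev.
Context {R : realType} {n : nat}.
Variables (p : R) (Omega : set 'rV[R]_n.+1).
Hypotheses (p1 : 1 < p) (pd : p < n.+1%:R).
Hypotheses (oOmega : open Omega) (bOmega : bounded_set Omega).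

Local Notation mu := (lebesgue_rV n.+1).
Let s := sobolev_exponent p n.+1%:R.
Let g := chain_exponent p n.+1%:R.
Let K := 2 `^ s * (g `^ s * (2 `^ p) `^ (s / p)).
Let mOmega : measurable Omega. Proof. exact: open_measurable_rV. Qed.
Let p0 : 0 < p. Proof. exact: lt_trans ltr01 p1. Qed.
Let ps : p < s. Proof. exact: sobolev_exponent_gt. Qed.
Let s0 : 0 < s. Proof. exact: lt_trans p0 ps. Qed.

Lemma norm_L_poweR (c : R) (f : 'rV[R]_n.+1 -> R) : 0 < c ->
  (norm_L Omega c%:E f `^ c = \int[mu]_(x in Omega) (`|f x| `^ c)%:E)%E.
Proof.
move=> c0; rewrite /norm_L poweR_Lnorm ?gt_eqF// [RHS]integral_mkcond.
apply: eq_integral => x _; rewrite !patchE; case: ifP => _ //=.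
by rewrite normr0 powR0// gt_eqF.
Qed.

Lemma cvg0_poweR_lt (f : nat -> \bar R) (c e : R) : 0 < c -> 0 < e ->
  (forall k, 0 <= f k)%E -> f k @[k --> \oo] --> 0%E ->
  \forall k \near \oo, (f k `^ c < e%:E)%E.
Proof.
move=> c0 e0 f0 fcvg.
have /fcvg : nbhs (0%E : \bar R) [set y | (y < (e `^ c^-1)%:E)%E].
  by apply: open_nbhs_nbhs; split;
    [exact: open_ereal_lt_ereal|rewrite /= lte_fin powR_gt0].
move=> near_lt; near=> k; have : (f k < (e `^ c^-1)%:E)%E by near: k.
have := f0 k; case: (f k) => [x| |]//.
rewrite lee_fin !lte_fin => x0 xe.
have := gt0_ltr_powR c0 (_ : x \in Num.nneg) (_ : e `^ c^-1 \in Num.nneg) xe.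
by rewrite -powRrM mulVf ?gt_eqF// powRr1 ?ltW//; apply; rewrite nnegrE ?powR_ge0.
Unshelve. all: by end_near. Qed.

(** The bound t on the integral of |grad u|^p is strict so that some test function
    phi_k close to u still satisfies it, up to the factor 2^p. *)
Lemma sobolev_truncation (u : W01p p Omega) (M t : R) : 0 <= M ->
  (\int[mu]_(x in Omega) (enorm (Wgrad u x) `^ p)%:E < t%:E)%E ->
  (\int[mu]_(x in Omega) (Num.min `|u x| M `^ s)%:E <=
    (K * t `^ (s / p))%:E)%E.
Proof.
move=> M0; set D := (\int[mu]_(x in Omega) _)%E => Dt.
have D0 : (0 <= D)%E by apply: integral_ge0 => x _; rewrite lee_fin powR_ge0.
apply/lee_addgt0Pr => e e0.
pose c := M `^ (s - p) * 2 `^ p.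
have c0 : 0 <= c by rewrite mulr_ge0 ?powR_ge0.
have [phi [tphi phiu gphi]] := Wclosure u.
have eta0 : 0 < e / (c + 1) by rewrite divr_gt0// ltr_wpDl.
have Dfin : D \is a fin_num by rewrite ge0_fin_numE// (lt_trans Dt) ?ltry.
have theta0 : 0 < t - fine D.
  by rewrite subr_gt0 -lte_fin fineK.
have near1 := cvg0_poweR_lt p0 eta0 (fun k => Lnorm_ge0 _ _ _) phiu.
have near2 := cvg0_poweR_lt p0 theta0 (fun k => Lnorm_ge0 _ _ _) gphi.
have [k [/ltW]] := filter_ex (filterI near1 near2).
rewrite !norm_L_poweR// => fk /ltW gk.
have mu_ : measurable_fun Omega u by case: (Wfun_Lp u).
have mphi : measurable_fun Omega (phi k).
  apply: measurable_funTS; apply: continuous_measurable_rV.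
  exact: test_continuous (tphi k).
have mgu : measurable_fun Omega (fun x => enorm (Wgrad u x)).
  by apply: measurable_enorm => i; case: (Wgrad_Lp u i).
have mgp : measurable_fun Omega (fun x => enorm (gradient (phi k) x)).
  apply: measurable_enorm => i; apply: measurable_funTS.
  under eq_fun do rewrite mxE.
  by apply: continuous_measurable_rV; exact: (test_partial_continuous (tphi k)).
have mgd : measurable_fun Omega (fun x => enorm (gradient (phi k) x - Wgrad u x)).
  apply: measurable_enorm => i.
  rewrite (_ : (fun x => _) = (fun x => partial i (phi k) x - Wgrad u x ord0 i)).
    apply: measurable_funB; last by case: (Wgrad_Lp u i).
    apply: measurable_funTS; apply: continuous_measurable_rV.
    exact: (test_partial_continuous (tphi k)).
  by apply/funext => x; rewrite !mxE.
have gradk : (\int[mu]_(x in Omega) (enorm (gradient (phi k) x) `^ p)%:E <=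
    (2 `^ p * t)%:E)%E.
  apply: (@le_trans _ _ (\int[mu]_(x in Omega)
    ((2 `^ p)%:E * ((enorm (Wgrad u x) `^ p)%:E +
      (`|enorm (gradient (phi k) x - Wgrad u x)| `^ p)%:E)))%E).
    apply: ge0_le_integral; first exact: mOmega.
    - by move=> x _; rewrite lee_fin powR_ge0.
    - exact: measurable_EFin_powR.
    - apply: emeasurable_funM => //; apply: emeasurable_funD.
        exact: measurable_EFin_powR.
      exact: measurable_EFin_norm_powR.
    - move=> x _; rewrite -EFinD -EFinM lee_fin (ger0_norm (sqrtr_ge0 _)).
      exact: enorm_powR_le.
  rewrite ge0_integralZl; last 4 first.
  - exact: mOmega.
  - by apply: emeasurable_funD; [exact: measurable_EFin_powR|exact: measurable_EFin_norm_powR].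
  - by move=> x _; rewrite adde_ge0// lee_fin powR_ge0.
  - by rewrite lee_fin powR_ge0.
  rewrite ge0_integralD; last 5 first.
  - exact: mOmega.
  - by move=> x _; rewrite lee_fin powR_ge0.
  - exact: measurable_EFin_powR.
  - by move=> x _; rewrite lee_fin powR_ge0.
  - exact: measurable_EFin_norm_powR.
  rewrite EFinM; apply: lee_wpmul2l; first by rewrite lee_fin powR_ge0.
  apply: (le_trans (leeD2l _ gk)).
  by rewrite -/D -[X in (X + _)%E](fineK Dfin) -EFinD addrC subrK.
apply: (@le_trans _ _ (\int[mu]_(x in Omega)
  ((2 `^ s)%:E * (`|phi k x| `^ s)%:E + c%:E * (`|phi k x - u x| `^ p)%:E))%E).
  apply: ge0_le_integral; first exact: mOmega.
  - by move=> x _; rewrite lee_fin powR_ge0.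
  - by apply: measurable_EFin_powR; apply: measurable_minr => //; exact: measurableT_comp.
  - apply: emeasurable_funD; apply: emeasurable_funM => //.
      exact: measurable_EFin_norm_powR.
    by apply: measurable_EFin_norm_powR; exact: measurable_funB.
  - by move=> x _; rewrite -!EFinM -EFinD lee_fin truncation_le_powR// ltW.
rewrite ge0_integralD; last 5 first.
- exact: mOmega.
- by move=> x _; rewrite -EFinM lee_fin mulr_ge0 ?powR_ge0.
- by apply: emeasurable_funM => //; exact: measurable_EFin_norm_powR.
- by move=> x _; rewrite -EFinM lee_fin mulr_ge0 ?powR_ge0.
- by apply: emeasurable_funM => //; apply: measurable_EFin_norm_powR; exact: measurable_funB.
rewrite (ge0_integralZl mu mOmega (measurable_EFin_norm_powR _ mphi)); last 2 first.
- by move=> x _; rewrite lee_fin powR_ge0.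
- by rewrite lee_fin powR_ge0.
rewrite (ge0_integralZl mu mOmega
  (measurable_EFin_norm_powR _ (measurable_funB mphi mu_))); last 2 first.
- by move=> x _; rewrite lee_fin powR_ge0.
- by rewrite lee_fin.
apply: leeD.
  rewrite /K -mulrA EFinM; apply: lee_wpmul2l; first by rewrite lee_fin powR_ge0.
  apply: (le_trans (sobolev_test_function p1 pd oOmega bOmega (tphi k))).
  rewrite -mulrA EFinM; apply: lee_wpmul2l; first by rewrite lee_fin powR_ge0.
  have t0 : 0 < t.
    by rewrite -lte_fin; exact: le_lt_trans Dt.
  have I0 : (0 <= \int[mu]_(x in Omega) (enorm (gradient (phi k) x) `^ p)%:E)%E.
    by apply: integral_ge0 => x _; rewrite lee_fin powR_ge0.
  rewrite -powRM ?powR_ge0 ?(ltW t0)// EFin_poweR_le//.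
  by rewrite divr_ge0// ltW.
apply: (le_trans (lee_wpmul2l _ fk)); first by rewrite lee_fin.
rewrite -EFinM lee_fin mulrA ler_pdivrMr ?ltr_wpDl// mulrDr mulr1 (mulrC c).
by rewrite lerDl ltW.
Qed.

(** For a positive integral D of |grad u|^p take t = 2 D, and let t tend to 0 when
    D = 0. *)
Lemma sobolev_truncation_homogeneous (u : W01p p Omega) (M : R) : 0 <= M ->
  (\int[mu]_(x in Omega) (Num.min `|u x| M `^ s)%:E <=
    (K * 2 `^ (s / p))%:E *
    (\int[mu]_(x in Omega) (enorm (Wgrad u x) `^ p)%:E) `^ (s / p))%E.
Proof.
move=> M0; have := fun t => @sobolev_truncation u M t M0; set D := (\int[mu]_(x in Omega) _)%E.
have D0 : (0 <= D)%E by apply: integral_ge0 => x _; rewrite lee_fin powR_ge0.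
have sp0 : 0 < s / p by exact: divr_gt0.
have K0 : 0 < K.
  rewrite /K !mulr_gt0// !powR_gt0//.
  by apply: lt_trans ltr01 _; exact: chain_exponent_gt1.
move: D0; case: D => [d| |]//; last first.
  move=> _ _; rewrite poweRyr ?gt_eqF//.
  by rewrite gt0_muley ?leey// lte_fin mulr_gt0// powR_gt0.
rewrite lee_fin le_eqVlt => /predU1P[<-|d0] H.
  rewrite poweR0r ?gt_eqF// mule0; apply/lee_addgt0Pr => e e0; rewrite add0e.
  (* chosen so that K t^(s/p) = e *)
  have t0 : 0 < (e / K) `^ (s / p)^-1 by rewrite powR_gt0 ?divr_gt0.
  apply: (le_trans (H _ t0)).
  rewrite -powRrM mulVf ?gt_eqF// powRr1 ?(divr_ge0 (ltW e0) (ltW K0))//.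
  by rewrite lee_fin mulrC divfK ?gt_eqF.
apply: le_trans (H (2 * d) _) _; first by rewrite lte_fin; lra.
by rewrite lee_fin powRM ?(ltW d0)// mulrA.
Qed.

Lemma sobolev_inequality : exists2 C : R, 0 < C & forall u : W01p p Omega,
  (\int[mu]_(x in Omega) (`|u x| `^ s)%:E <=
    C%:E * norm_W u `^ s)%E.
Proof.
exists (K * 2 `^ (s / p)) => [|u].
  rewrite !mulr_gt0 ?powR_gt0//.
  by apply: lt_trans ltr01 _; exact: chain_exponent_gt1.
have -> : (norm_W u `^ s =
    (\int[mu]_(x in Omega) (enorm (Wgrad u x) `^ p)%:E) `^ (s / p))%E.
  have {1}-> : s = p * (s / p) by rewrite mulrC divfK ?gt_eqF.
  rewrite /norm_W poweRrM (norm_L_poweR _ p0); congr (_ `^ _)%E.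
  by apply: eq_integral => x _; rewrite (ger0_norm (sqrtr_ge0 _)).
have mu_ : measurable_fun Omega u by case: (Wfun_Lp u).
pose f m x := (Num.min `|u x| m%:R `^ s)%:E.
have fcvg x : f^~ x m @[m --> \oo] --> (`|u x| `^ s)%:E.
  apply: cvg_near_cst; exists (Num.trunc `|u x|).+1 => // m /= um.
  rewrite /f min_l// ltW// (lt_le_trans (truncnS_gt _))// ler_nat//.
rewrite (eq_integral (fun x => limn (f^~ x))); last first.
  by move=> x _; apply/esym/cvg_lim => //; exact: fcvg.
have mf m : measurable_fun Omega (f m).
  by apply: measurable_EFin_powR; apply: measurable_minr => //; exact: measurableT_comp.
have f0 m x : Omega x -> (0 <= f m x)%E by rewrite lee_fin powR_ge0.
have ndf x : Omega x -> {homo f^~ x : a b / (a <= b)%N >-> (a <= b)%E}.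
  move=> _ a b ab; rewrite lee_fin; apply: ge0_ler_powR.
  - exact: ltW.
  - by rewrite nnegrE le_min normr_ge0 ler0n.
  - by rewrite nnegrE le_min normr_ge0 ler0n.
  - by rewrite le_min !ge_min lexx/= ler_nat ab orbT.
rewrite monotone_convergence//; apply: lime_le.
  apply: ereal_nondecreasing_is_cvgn => a b ab.
  by apply: ge0_le_integral => // [x|x] Ox; [exact: f0|exact: ndf].
by apply: nearW => m; exact: sobolev_truncation_homogeneous.
Qed.

End sobolev.

(** * Nonnegativity of the energy near the origin *)

Section pointwise_absorption.
Context {R : realType}.
Implicit Types (a c q w s : R).

(** The value of |a| at which c |a|^w and |a|^q / q are equal. *)
Definition absorption_threshold c q w : R := (c * q)^-1 `^ (w - q)^-1.

Lemma absorption_threshold_gt0 c q w : 0 < c -> 0 < q ->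
  0 < absorption_threshold c q w.
Proof. by move=> c0 q0; rewrite powR_gt0 ?invr_gt0 ?mulr_gt0. Qed.

Lemma absorption_le c q w a : 0 < c -> 0 < q -> q < w ->
  `|a| <= absorption_threshold c q w -> c * `|a| `^ w <= q^-1 * `|a| `^ q.
Proof.
move=> c0 q0 qw ad; have wq0 : 0 < w - q by rewrite subr_gt0.
have -> : `|a| `^ w = `|a| `^ (w - q) * `|a| `^ q.
  by rewrite -powRD subrK// gt_eqF// (lt_trans q0).
rewrite mulrA; apply: ler_wpM2r; first exact: powR_ge0.
have : `|a| `^ (w - q) <= absorption_threshold c q w `^ (w - q).
  by apply: ge0_ler_powR; rewrite ?nnegrE ?powR_ge0 ?(ltW wq0).
rewrite /absorption_threshold -powRrM mulVf ?gt_eqF// powRr1; last first.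
  by rewrite invr_ge0 mulr_ge0 ?ltW.
by rewrite invfM ler_pdivlMl.
Qed.

(** Below the threshold the first term on the right suffices, above it the second
    one, because w - s < 0. *)
Lemma absorption_critical_le c q w s a : 0 < c -> 0 < q -> q < w -> w < s ->
  c * `|a| `^ w <=
  q^-1 * `|a| `^ q + c * absorption_threshold c q w `^ (w - s) * `|a| `^ s.
Proof.
move=> c0 q0 qw ws; have d0 := absorption_threshold_gt0 w c0 q0.
have [ad|/ltW ad] := leP `|a| (absorption_threshold c q w).
  apply: ler_wpDr; last exact: absorption_le.
  by rewrite !mulr_ge0 ?powR_ge0// ltW.
have a0 : 0 < `|a| by exact: lt_le_trans ad.
apply: ler_wpDl; first by rewrite mulr_ge0 ?powR_ge0// invr_ge0 ltW.
rewrite -mulrA ler_pM2l//.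
have -> : `|a| `^ w = `|a| `^ (w - s) * `|a| `^ s.
  by rewrite -powRD subrK// gt_eqF// (lt_trans q0).
apply: ler_wpM2r; first exact: powR_ge0.
rewrite -(opprB s w) !powRN lef_pV2 ?posrE; [|exact: powR_gt0|exact: powR_gt0].
by apply: ge0_ler_powR; rewrite ?nnegrE ?subr_ge0// ltW.
Qed.

(** Together with the finite measure of Omega, it makes the integral of |v|^w
    finite. *)
Lemma powR_le_add1 w s a : 0 <= w -> w <= s -> `|a| `^ w <= 1 + `|a| `^ s.
Proof.
move=> w0 ws; have [a1|/ltW a1] := leP `|a| 1.
  apply: ler_wpDr; first exact: powR_ge0.
  apply: (@le_trans _ _ (1 `^ w)); last by rewrite powR1.
  by apply: ge0_ler_powR; rewrite ?nnegrE.
by apply: ler_wpDl => //; exact: ler_powR.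
Qed.

End pointwise_absorption.

Section local_minimum.
Context {R : realType} {n : nat}.
Variables (p : R) (Omega : set 'rV[R]_n.+1) (r q w lambda : R).
Hypotheses (p1 : 1 < p) (pd : p < n.+1%:R).
Hypotheses (oOmega : open Omega) (bOmega : bounded_set Omega).
Let s := sobolev_exponent p n.+1%:R.
Hypotheses (r0 : 0 < r) (rs : r < s) (ws : w < s) (qw : q < w) (q1 : 1 <= q).

Local Notation mu := (lebesgue_rV n.+1).
Let mOmega : measurable Omega. Proof. exact: open_measurable_rV. Qed.
Let q0 : 0 < q. Proof. exact: lt_le_trans ltr01 q1. Qed.
Let w0 : 0 < w. Proof. exact: lt_trans q0 qw. Qed.
Let s0 : 0 < s. Proof. exact: lt_trans w0 ws. Qed.
Let c := lambda / w.

(** Both functionals at once: v is u itself or its positive part. *)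
Definition energy (u : W01p p Omega) (v : 'rV[R]_n.+1 -> R) : \bar R :=
  ((r^-1)%:E * norm_W u `^ r + (q^-1)%:E * norm_L Omega q%:E v `^ q
  - (lambda / w)%:E * norm_L Omega w%:E v `^ w)%E.

Let norm_powR_ge0 (v : 'rV[R]_n.+1 -> R) a x : (0 <= (`|v x| `^ a)%:E)%E.
Proof. by rewrite lee_fin powR_ge0. Qed.

(** The last integral must be known to be finite: otherwise the difference could
    be of the form +oo - +oo, which is -oo in the extended reals. *)
Lemma energy_ge0 (u : W01p p Omega) (v : 'rV[R]_n.+1 -> R) :
  (c <= 0 \/
    (\int[mu]_(x in Omega) (`|v x| `^ w)%:E < +oo)%E /\
    (c%:E * \int[mu]_(x in Omega) (`|v x| `^ w)%:E <=
     (r^-1)%:E * norm_W u `^ r +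
     (q^-1)%:E * \int[mu]_(x in Omega) (`|v x| `^ q)%:E)%E) ->
  (0 <= energy u v)%E.
Proof.
rewrite /energy !norm_L_poweR// -/c.
set A := ((r^-1)%:E * norm_W u `^ r)%E.
set B := ((q^-1)%:E * _)%E; set C := (\int[mu]_(x in Omega) (`|v x| `^ w)%:E)%E.
have A0 : (0 <= A)%E by rewrite mule_ge0 ?poweR_ge0// lee_fin invr_ge0 ltW.
have B0 : (0 <= B)%E.
  by rewrite mule_ge0 ?integral_ge0// lee_fin invr_ge0 ltW.
have C0 : (0 <= C)%E by exact: integral_ge0.
move=> [c0|[Coo cC]].
  rewrite adde_ge0 ?adde_ge0// oppe_ge0 mule_le0_ge0// lee_fin//.
rewrite sube_ge0// ; apply/orP; left.
by rewrite fin_numM// ge0_fin_numE.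
Qed.

Lemma energy_origin : energy (W_origin Omega p1) (cst 0) = 0%E.
Proof.
have p0 : 0 < p by exact: lt_trans ltr01 p1.
rewrite /energy; have -> : norm_W (W_origin Omega p1) = 0%E.
  rewrite /norm_W (_ : (fun x => _) = cst 0) ?norm_L0 ?eqe ?gt_eqF//.
  by apply/funext => x /=; exact: enorm0.
rewrite !norm_L0 ?eqe ?gt_eqF// !poweR0r ?gt_eqF//.
by rewrite !mule0 adde0 sube0.
Qed.

(** With rho the absorption threshold, the inequality of integrals holds pointwise
    almost everywhere. *)
Lemma energy_Linfty_ge0 : exists2 rho : R, 0 < rho &
  forall (u : W01p p Omega) (v : 'rV[R]_n.+1 -> R), measurable_fun Omega v ->
    (forall x, `|v x| <= `|u x|) -> (norm_L Omega +oo u < rho%:E)%E ->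
    (0 <= energy u v)%E.
Proof.
have [c_le0|c_gt0] := leP c 0.
  by exists 1 => // u v _ _ _; apply: energy_ge0; left.
set d := absorption_threshold c q w.
have d0 : 0 < d by exact: absorption_threshold_gt0.
exists d => // u v mv vu ud.
have ae_v : {ae mu, forall x, Omega x -> `|v x| <= d}.
  have : {ae mu, forall x, (`| ((EFin \o u) \_ Omega) x | <= d%:E)%E}.
    move: ud; rewrite /norm_L unlock; case: ifPn => [_ /ltW /ess_supP//|].
    rewrite -leNgt measure_le0 => /eqP mu0 _.
    exists setT; split => //; exact: measurableT.
  apply: filterS => x + Ox; rewrite patchE mem_set//= lee_fin.
  exact: le_trans.
have Vfin : (\int[mu]_(x in Omega) (`|v x| `^ w)%:E < +oo)%E.
  apply: (@le_lt_trans _ _ (\int[mu]_(x in Omega) cst (d `^ w)%:E x)%E).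
    apply: ae_ge0_le_integral => //.
    - exact: measurable_EFin_norm_powR.
    - by move=> x _ /=; rewrite lee_fin powR_ge0.
    - apply: filterS ae_v => x vd Ox /=; rewrite lee_fin.
      by apply: ge0_ler_powR; rewrite ?nnegrE ?(ltW d0) ?(ltW w0) ?vd.
  rewrite integral_cst// lte_mul_pinfty ?lee_fin ?powR_ge0//.
  exact: bounded_set_lebesgue_lty.
apply: energy_ge0; right; split => //.
apply: (@le_trans _ _ ((q^-1)%:E * \int[mu]_(x in Omega) (`|v x| `^ q)%:E)%E).
  rewrite -!ge0_integralZl//; last 4 first.
  - exact: measurable_EFin_norm_powR.
  - by rewrite lee_fin invr_ge0 ltW.
  - exact: measurable_EFin_norm_powR.
  - by rewrite lee_fin ltW.
  apply: ae_ge0_le_integral => //.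
  - by move=> x _; rewrite mule_ge0// lee_fin ltW.
  - by apply: emeasurable_funM => //; exact: measurable_EFin_norm_powR.
  - by move=> x _; rewrite mule_ge0// lee_fin invr_ge0 ltW.
  - by apply: emeasurable_funM => //; exact: measurable_EFin_norm_powR.
  apply: filterS ae_v => x vd Ox; rewrite -!EFinM lee_fin.
  exact: absorption_le (vd Ox).
by apply: leeDr; rewrite mule_ge0 ?poweR_ge0// lee_fin invr_ge0 ltW.
Qed.

(** The critical term left by absorption_critical_le is at most k t^s with t the W
    norm of u, and k t^s <= t^r / r as soon as t^(s - r) <= 1 / (r k). *)
Lemma energy_W_ge0 : exists2 rho : R, 0 < rho &
  forall (u : W01p p Omega) (v : 'rV[R]_n.+1 -> R), measurable_fun Omega v ->
    (forall x, `|v x| <= `|u x|) -> (norm_W u < rho%:E)%E ->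
    (0 <= energy u v)%E.
Proof.
have [c_le0|c_gt0] := leP c 0.
  by exists 1 => // u v _ _ _; apply: energy_ge0; left.
pose d := absorption_threshold c q w.
have d0 : 0 < d by exact: absorption_threshold_gt0.
have [K K0 sobolev] := sobolev_inequality p1 pd oOmega bOmega.
pose k := c * d `^ (w - s) * K.
have cd0 : 0 < c * d `^ (w - s) by apply: mulr_gt0 => //; exact: powR_gt0.
have k0 : 0 < k by exact: mulr_gt0.
have sr0 : 0 < s - r by rewrite subr_gt0.
(* the value of t for which k t^s = t^r / r *)
exists ((r * k)^-1 `^ (s - r)^-1).
  by rewrite powR_gt0// invr_gt0 mulr_gt0.
move=> u v mv vu.
have : (0 <= norm_W u)%E by exact: Lnorm_ge0.
have := sobolev u; case E : (norm_W u) => [t| |]//.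
rewrite lee_fin lte_fin => uK t0 trho.
have mu_ : measurable_fun Omega u by case: (Wfun_Lp u).
have vK : (\int[mu]_(x in Omega) (`|v x| `^ s)%:E <= (K * t `^ s)%:E)%E.
  apply: le_trans uK; apply: ge0_le_integral; first exact: mOmega.
  - by move=> x _; exact: norm_powR_ge0.
  - exact: measurable_EFin_norm_powR.
  - exact: measurable_EFin_norm_powR.
  - move=> x _; rewrite lee_fin; apply: ge0_ler_powR; rewrite ?nnegrE//.
    exact: ltW.
have kt : k * t `^ s <= r^-1 * t `^ r.
  have -> : t `^ s = t `^ (s - r) * t `^ r.
    by rewrite -powRD subrK// gt_eqF.
  rewrite mulrA; apply: ler_wpM2r; first exact: powR_ge0.
  have : t `^ (s - r) <= ((r * k)^-1 `^ (s - r)^-1) `^ (s - r).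
    by apply: ge0_ler_powR; rewrite ?nnegrE ?powR_ge0 ?(ltW sr0) ?(ltW trho).
  rewrite -powRrM mulVf ?gt_eqF// powRr1; last by rewrite invr_ge0 mulr_ge0 ?ltW.
  by rewrite invfM ler_pdivlMr// (mulrC k).
apply: energy_ge0; right; split.
  apply: (@le_lt_trans _ _
      (\int[mu]_(x in Omega) (cst 1%E x + (`|v x| `^ s)%:E))%E).
    apply: ge0_le_integral; first exact: mOmega.
    - by move=> x _; exact: norm_powR_ge0.
    - exact: measurable_EFin_norm_powR.
    - by apply: emeasurable_funD => //; exact: measurable_EFin_norm_powR.
    - by move=> x _; rewrite -EFinD lee_fin powR_le_add1// ltW.
  rewrite ge0_integralD//; last exact: measurable_EFin_norm_powR.
  rewrite integral_cst// mul1e lte_add_pinfty//.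
    exact: bounded_set_lebesgue_lty.
  exact: le_lt_trans vK (ltry _).
rewrite E.
apply: (@le_trans _ _ (\int[mu]_(x in Omega)
    ((c * d `^ (w - s))%:E * (`|v x| `^ s)%:E + (q^-1)%:E * (`|v x| `^ q)%:E))%E).
  rewrite -ge0_integralZl//; last 2 first.
  - exact: measurable_EFin_norm_powR.
  - by rewrite lee_fin ltW.
  apply: ge0_le_integral; first exact: mOmega.
  - by move=> x _; rewrite mule_ge0// lee_fin ltW.
  - by apply: emeasurable_funM => //; exact: measurable_EFin_norm_powR.
  - by apply: emeasurable_funD; apply: emeasurable_funM => //;
      exact: measurable_EFin_norm_powR.
  - move=> x _; rewrite -!EFinM -EFinD lee_fin addrC.
    exact: absorption_critical_le.
rewrite ge0_integralD; last 5 first.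
- exact: mOmega.
- by move=> x _; rewrite mule_ge0// lee_fin ltW.
- by apply: emeasurable_funM => //; exact: measurable_EFin_norm_powR.
- by move=> x _; rewrite mule_ge0// lee_fin invr_ge0 ltW.
- by apply: emeasurable_funM => //; exact: measurable_EFin_norm_powR.
rewrite (ge0_integralZl mu mOmega (measurable_EFin_norm_powR q mv));
  rewrite ?lee_fin ?invr_ge0 ?(ltW q0)//.
rewrite (ge0_integralZl mu mOmega (measurable_EFin_norm_powR s mv)) ?lee_fin ?(ltW cd0)//.
apply: leeD2r; apply: le_trans (lee_wpmul2l _ vK) _.
  by rewrite lee_fin ltW.
by rewrite -!EFinM lee_fin mulrA.
Qed.

End local_minimum.

Lemma pos_part_le (R : realType) n (u : 'rV[R]_n -> R) x :
  `|pos_part u x| <= `|u x|.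
Proof.
rewrite /pos_part; have [u0|u0] := leP (u x) 0; first by rewrite normr0.
by [].
Qed.

Theorem corollary3p3 (R : realType) (N : nat) (p : R) (Omega : set 'rV[R]_N)
    (r q varpi lambda : R) (p1 : 1 < p) (pN : p < N%:R)
    (hOmega : bounded_smooth_domain Omega)
    (hr : 0 < r < p * N%:R / (N%:R - p))
    (hvarpi : varpi < p * N%:R / (N%:R - p))
    (hqvarpi : q < varpi) (hq : 1 <= q) :
  let J := @J_functional R N r q varpi lambda p Omega in
  let Jplus := @Jplus_functional R N r q varpi lambda p Omega in
  let norm_Linfty := fun u : W01p p Omega => norm_L Omega +oo%E u in
  let norm_W1p := fun u : W01p p Omega => norm_W u in
  [/\ origin_local_min p1 norm_Linfty J,
      origin_local_min p1 norm_W1p J,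
      origin_local_min p1 norm_Linfty Jplus &
      origin_local_min p1 norm_W1p Jplus].
Proof.
move=> J Jplus norm_Linfty norm_W1p.
case: N => [|n] in Omega pN hOmega hr hvarpi J Jplus norm_Linfty norm_W1p *.
  by have := lt_trans (lt_trans ltr01 p1) pN; rewrite ltxx.
have [_ oOmega _ bOmega _] := hOmega; have /andP[r0 rs] := hr.
have measurable_pos_part (u : W01p p Omega) : measurable_fun Omega (pos_part u).
  by apply: measurable_maxr => //; case: (Wfun_Lp u).
have J_origin : J (W_origin Omega p1) = 0%E.
  exact: (energy_origin Omega lambda p1 r0 hqvarpi hq).
have Jplus_origin : Jplus (W_origin Omega p1) = 0%E.
  rewrite -(energy_origin Omega lambda p1 r0 hqvarpi hq).
  rewrite /Jplus /Jplus_functional /energy.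
  rewrite (_ : pos_part (W_origin Omega p1) = cst 0)//.
  by apply/funext => x; rewrite /pos_part maxxx.
have [rho rho0 minoo] :=
  energy_Linfty_ge0 p lambda oOmega bOmega r0 hqvarpi hq.
have [sigma sigma0 minW] :=
  energy_W_ge0 lambda p1 pN oOmega bOmega r0 rs hvarpi hqvarpi hq.
split; [exists rho|exists sigma|exists rho|exists sigma] => // u small;
  rewrite ?J_origin ?Jplus_origin.
- by apply: minoo small => //; case: (Wfun_Lp u).
- by apply: minW small => //; case: (Wfun_Lp u).
- by apply: minoo small => // x; exact: pos_part_le.
- by apply: minW small => // x; exact: pos_part_le.
Qed.
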